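(* Let $d\ge1$ be an integer, let $\Omega=\{\boldsymbol{x}_1,\dots,\boldsymbol{x}_n\}$ be a set of $n$ distinct vectors of $\mathbb{R}^d$, and let $\boldsymbol{L}_\varepsilon=[\kappa_\varepsilon(\boldsymbol{x}_i,\boldsymbol{x}_j)]_{i,j=1}^n$ for $\kappa$ a stationary kernel of (finite) smoothness order $r$. Assume that the Vandermonde matrix $\boldsymbol{V}_{\le r-1}$ of $\Omega$ has full column rank $\mathscr{P}_{r-1,d}$. Then for all $m$ with $\mathscr{P}_{r-1,d}\le m\le n$, as $\varepsilon\to0$ ($\varepsilon>0$), $\mathcal{X}_\varepsilon\sim|DPP|_m(\boldsymbol{L}_\varepsilon)$ converges to $$\mathcal{X}_\star\sim|DPP|_m\big((-1)^r\boldsymbol{D}^{(2r-1)};\boldsymbol{V}_{\le r-1}\big).$$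
   Context: Kernel: a positive definite function $\kappa:\mathbb{R}^d\times\mathbb{R}^d\to\mathbb{R}$ (the matrix $[\kappa(\boldsymbol{y}_i,\boldsymbol{y}_j)]_{i,j}$ is positive definite for any finitely many distinct points). It is stationary if $\kappa(\boldsymbol{x},\boldsymbol{y})=f(\|\boldsymbol{x}-\boldsymbol{y}\|_2)$ for a function $f$; $f$ is assumed analytic in a neighbourhood of $0$, $f(t)=\sum_{i\ge0}f_it^i$, and $\kappa_\varepsilon(\boldsymbol{x},\boldsymbol{y})=f(\varepsilon\|\boldsymbol{x}-\boldsymbol{y}\|_2)$. Smoothness order: $r=\min\{r\ge1:f_{2r-1}\neq0\}$. $\mathscr{P}_{k,d}=\binom{k+d}{d}$. $\boldsymbol{V}_{\le k}\in\mathbb{R}^{n\times\mathscr{P}_{k,d}}$ is the multivariate Vandermonde matrix, whose columns are the monomials of degree $\le k$ in $d$ variables (ordered by increasing degree) evaluated at the points of $\Omega$. $\boldsymbol{D}^{(s)}=[\|\boldsymbol{x}_i-\boldsymbol{x}_j\|_2^s]_{i,j=1}^n$. Fixed-size L-ensemble: $\mathcal{X}\sim|DPP|_m(\boldsymbol{L})$, $\boldsymbol{L}$ positive semi-definite, means $\mathbf{P}(\mathcal{X}=X)\propto\det(\boldsymbol{L}_X)$ if $|X|=m$, and $0$ otherwise. Fixed-size partial-projection DPP: for $\boldsymbol{L}$ symmetric and $\boldsymbol{V}\in\mathbb{R}^{n\times p}$ of full column rank such that $\boldsymbol{x}^\top\boldsymbol{L}\boldsymbol{x}\ge0$ whenever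 $\boldsymbol{V}^\top\boldsymbol{x}=0$, $\mathcal{X}\sim|DPP|_m(\boldsymbol{L};\boldsymbol{V})$ means $\mathbf{P}(\mathcal{X}=X)\propto(-1)^p\det\begin{pmatrix}\boldsymbol{L}_X&\boldsymbol{V}_{X,:}\\(\boldsymbol{V}_{X,:})^\top&\boldsymbol{0}\end{pmatrix}$ if $|X|=m$, and $0$ otherwise. Here $\boldsymbol{L}_X$ is the principal submatrix indexed by $X$ and $\boldsymbol{V}_{X,:}$ the submatrix of rows in $X$. Convergence: $\mathbf{P}(\mathcal{X}_\varepsilon=X)\to\mathbf{P}(\mathcal{X}_\star=X)$ for every $X\subseteq\Omega$. *)

(* Defs.v *)
From HB Require Import structures.
From mathcomp Require Import all_boot all_order all_algebra.
From mathcomp Require Import all_classical all_reals all_analysis.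

Set Implicit Arguments.
Unset Strict Implicit.
Unset Printing Implicit Defensive.

Import Order.TTheory GRing.Theory Num.Theory.
Import numFieldNormedType.Exports.

Local Open Scope classical_set_scope.
Local Open Scope ring_scope.

(* The canonical norm of MathComp-Analysis on row vectors is the sup norm. *)
Definition l2norm (R : realType) (d : nat) (u : 'rV[R]_d) : R :=
  Num.sqrt (\sum_(l < d) u 0 l ^+ 2).

Definition posdefmx (R : realType) (n : nat) (A : 'M[R]_n) : Prop :=
  A^T = A /\ forall u : 'cV[R]_n, u != 0 -> 0 < (u^T *m A *m u) 0 0.

Definition possemidefmx (R : realType) (n : nat) (A : 'M[R]_n) : Prop :=
  A^T = A /\ forall u : 'cV[R]_n, 0 <= (u^T *m A *m u) 0 0.

Definition posdef_kernel (R : realType) (d : nat)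
    (kappa : 'rV[R]_d -> 'rV[R]_d -> R) : Prop :=
  forall (k : nat) (y : 'I_k -> 'rV[R]_d), injective y ->
    posdefmx (\matrix_(i < k, j < k) kappa (y i) (y j)).

Definition stationary (R : realType) (d : nat)
    (kappa : 'rV[R]_d -> 'rV[R]_d -> R) (f : R -> R) : Prop :=
  forall u v : 'rV[R]_d, kappa u v = f (l2norm (u - v)).

Definition power_series_at0 (R : realType) (f : R -> R) (a : nat -> R) : Prop :=
  \forall t \near (0 : R), pseries a t n @[n --> \oo] --> f t.

Definition smoothness_order (R : realType) (a : nat -> R) (r : nat) : Prop :=
  [/\ (1 <= r)%N, a (2 * r - 1)%N != 0 &
      forall s : nat, (1 <= s)%N -> a (2 * s - 1)%N != 0 -> (r <= s)%N].

Definition scaled_kernel (R : realType) (d : nat) (f : R -> R) (eps : R)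
    (u v : 'rV[R]_d) : R :=
  f (eps * l2norm (u - v)).

Definition kernel_mx (R : realType) (d n : nat)
    (kappa : 'rV[R]_d -> 'rV[R]_d -> R) (x : 'I_n -> 'rV[R]_d) : 'M[R]_n :=
  \matrix_(i < n, j < n) kappa (x i) (x j).

Definition dist_mx (R : realType) (d n : nat) (s : nat)
    (x : 'I_n -> 'rV[R]_d) : 'M[R]_n :=
  \matrix_(i < n, j < n) l2norm (x i - x j) ^+ s.

Definition mdegree (k d : nat) (alpha : d.-tuple 'I_k.+1) : nat :=
  (\sum_(i <- alpha) i)%N.

(* A monomial is given by its exponents, all at most k when its degree is;
   ties between monomials of equal degree are broken by the enumeration
   order of the tuple type. *)
Definition monomials (k d : nat) : seq (d.-tuple 'I_k.+1) :=
  sort (fun alpha beta => mdegree alpha <= mdegree beta)%N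
       (enum [set alpha : d.-tuple 'I_k.+1 | (mdegree alpha <= k)%N]%SET).

Lemma size_monomials (k d : nat) : size (monomials k d) = 'C(k + d, d).
Proof. by rewrite size_sort -cardE card_partial_ord_partitions addnC. Qed.

(* By size_monomials, the default value of nth is never used. *)
Definition vandermonde (R : realType) (d n k : nat) (x : 'I_n -> 'rV[R]_d) :
    'M[R]_(n, 'C(k + d, d)) :=
  \matrix_(i < n, j < 'C(k + d, d))
    \prod_(l < d)
      x i 0 l ^+ tnth (nth [tuple of nseq d ord0] (monomials k d) j) l.

Definition principal_submx (R : realType) (n : nat) (X : {set 'I_n})
    (A : 'M[R]_n) : 'M[R]_#|X| :=
  mxsub (fun i : 'I_#|X| => enum_val i) (fun j : 'I_#|X| => enum_val j) A.

Definition row_submx (R : realType) (n p : nat) (X : {set 'I_n})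
    (V : 'M[R]_(n, p)) : 'M[R]_(#|X|, p) :=
  rowsub (fun i : 'I_#|X| => enum_val i) V.

(* The law of a random subset of {x_1, ..., x_n}, subsets being identified
   with sets of indices: P X is the probability that the random subset is X. *)
Definition set_law (R : realType) (n : nat) (P : {set 'I_n} -> R) : Prop :=
  (forall X, 0 <= P X) /\ \sum_X P X = 1.

Definition fixed_size_law (R : realType) (n m : nat) (w : {set 'I_n} -> R)
    (P : {set 'I_n} -> R) : Prop :=
  set_law P /\
  exists2 c : R, 0 < c & forall X, P X = if #|X| == m then c * w X else 0.

Definition fixed_size_dpp (R : realType) (n m : nat) (L : 'M[R]_n)
    (P : {set 'I_n} -> R) : Prop :=
  possemidefmx L /\
  fixed_size_law m (fun X => \det (principal_submx X L)) P.

Definition fixed_size_ppdpp (R : realType) (n m p : nat) (L : 'M[R]_n)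
    (V : 'M[R]_(n, p)) (P : {set 'I_n} -> R) : Prop :=
  [/\ L^T = L,
      \rank V = p,
      forall u : 'cV[R]_n, V^T *m u = 0 -> 0 <= (u^T *m L *m u) 0 0 &
      fixed_size_law m
        (fun X => (-1) ^+ p *
           \det (block_mx (principal_submx X L) (row_submx X V)
                          (row_submx X V)^T 0)) P].

(* Main.v *)
Require Import Defs.
From HB Require Import structures.
From mathcomp Require Import all_boot all_order all_algebra.
From mathcomp Require Import all_classical all_reals all_analysis.
From mathcomp Require Import ring lra zify.

(** Write [r = n + 1], so that the first odd coefficient of [f] has index
    [m = 2n + 1], and let [D] be the kernel [|u - v| ^ m]. Near the flat limit

      [f (e |u - v|) = (even terms of order at most 2n) + a_m e ^ m D + o(e ^ m)],

    where the even terms are polynomials in the two points. Their part made of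
    monomials of degree at most [n] in each point is [V M V^T], where [V] is
    the Vandermonde matrix and [M] is the matrix of coefficients [W], the
    Wronskian, rescaled by powers of [e]. The other polynomial terms have one
    monomial of degree more than [n], hence the other of degree less than [n];
    completing the square turns [V] into a perturbation of it and leaves a
    remainder of order [2n + 2]. A Schur complement then gives, for every
    subset [X] of size [l], with [p] columns in [V],

      [det L_X = e ^ (m (l - p)) det M * h_X (e)],
      [h_X (e) --> (-1) ^ p det (a_m D_X, V_X; V_X^T, 0)],

    ([det_flat_limit]). The factor in front of [h_X] is the same for all subsets
    and cancels in the probabilities, provided that it is not 0
    ([fixed_size_law_cvg]). So the theorem rests on two facts of positivity:
    the limit weights are nonnegative and not all 0, and [W] is invertible.

    Both are drawn from the positivity of the kernel on finitely supported
    signed measures on the whole space, at all small scales. A measure that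
    annihilates the polynomials of degree at most [n] does not see the even
    terms, so [a_m D] is nonnegative on it ([distk_form_ge0]). Applied to a
    finite difference on a line, where the form is the central value of a
    B-spline, this shows that the sign of [a_m] is [(-1) ^ r]
    ([odd_coef_sign]). The form is moreover definite: by Cauchy-Schwarz, the
    potential of a measure of form 0 is orthogonal to all differences that
    annihilate polynomials, but the potential of a nonzero measure is singular
    at its points ([distk_form_definite]). Hence the bordered determinants are
    positive when [V_X] has full rank, by a homotopy to the case where [L] is
    the identity ([bordered_det_gt0]), and they vanish otherwise.

    The Wronskian is treated in the same way ([low_form_definite]). A vector of
    its kernel is the vector of moments of a measure; combining the homogeneous
    components of this measure with suitable powers of [e] cancels all even
    terms, so that again the odd term decides the sign of the form. The
    component of highest degree [k], shrunk to a point, acts on functions as a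
    homogeneous differential operator of order [k]; Cauchy-Schwarz forces it to
    map [|y| ^ m] to a polynomial. But it maps it to [|y| ^ (m - 2k)] times a
    nonzero polynomial, homogeneous of degree [k], which is not a polynomial as
    [m - 2k] is odd. The nonvanishing holds because the expansion of
    [|y - z| ^ m] in [z] starts, up to degree [n + 1], with kernels whose form
    has a strict sign ([bil_jet_gt0]); these expansions come from the binomial
    series of exponent [n + 1/2] ([hbin_sqr], [jet_cvg]). *)

Set Implicit Arguments.
Unset Strict Implicit.
Unset Printing Implicit Defensive.

Import Order.TTheory GRing.Theory Num.Theory.
Import numFieldNormedType.Exports.

Local Open Scope classical_set_scope.
Local Open Scope ring_scope.

(** * Finite differences on the real line *)

Section Differences.
Variable R : realFieldType.
Implicit Types (g h : R -> R) (t c : R) (n N l : nat).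

Definition nabla g t : R := g t - g (t - 1).

Lemma nablanS n g t :
  iter n.+1 nabla g t = iter n nabla g t - iter n nabla g (t - 1).
Proof. by []. Qed.

Lemma eq_nablan n g h : g =1 h -> iter n nabla g =1 iter n nabla h.
Proof.
move=> gh; elim: n => [|n IHn] t /=; first exact: gh.
by rewrite /nabla !IHn.
Qed.

Lemma nablanD n g h t :
  iter n nabla (fun x => g x + h x) t = iter n nabla g t + iter n nabla h t.
Proof.
elim: n t => [//|n IHn] t /=; rewrite /nabla !IHn; ring.
Qed.

Lemma nablanZ n c g t :
  iter n nabla (fun x => c * g x) t = c * iter n nabla g t.
Proof. by elim: n t => [//|n IHn] t /=; rewrite /nabla !IHn mulrBr. Qed.

Lemma nablan_shift n c g t :
  iter n nabla (fun x => g (x + c)) t = iter n nabla g (t + c).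
Proof. by elim: n t => [//|n IHn] t /=; rewrite /nabla !IHn addrAC. Qed.

Lemma nablan_reflect n c g t :
  iter n nabla (fun x => g (c - x)) t
  = (-1) ^+ n * iter n nabla g (c - t + n%:R).
Proof.
elim: n t => [|n IHn] t /=; first by rewrite mul1r addr0.
rewrite /nabla !IHn exprS.
have -> : c - (t - 1) + n%:R = c - t + n.+1%:R by rewrite -natr1; ring.
have -> : c - t + n.+1%:R - 1 = c - t + n%:R by rewrite -natr1; ring.
ring.
Qed.

(** The Leibniz rule for a product with the identity. *)
Lemma nablan_id n g t :
  iter n.+1 nabla (fun x => x * g x) t
  = t * iter n.+1 nabla g t + n.+1%:R * iter n nabla g (t - 1).
Proof.
elim: n t => [|n IHn] t; first by rewrite /= /nabla; ring.
rewrite nablanS !IHn -(@natr1 _ n.+1) !(nablanS n.+1) !(nablanS n).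
ring.
Qed.

Lemma nablan_exp N l t : (l < N)%N -> iter N nabla (fun x => x ^+ l) t = 0.
Proof.
elim: l N t => [|l IHl] [//|N] t lN.
  elim: N t {lN} => [|N IHN] t; first by rewrite /= /nabla !expr0 subrr.
  by rewrite nablanS !IHN subrr.
have -> : iter N.+1 nabla (fun x => x ^+ l.+1) t
        = iter N.+1 nabla (fun x => x * x ^+ l) t.
  by apply: eq_nablan => x; rewrite exprS.
by rewrite nablan_id !IHl ?mulr0 ?addr0 // ltnW.
Qed.

(** Only the point 1 of the difference at 1 lies on the positive side. *)
Lemma nablan_at1 N g : (forall t, t <= 0 -> g t = 0) -> iter N nabla g 1 = g 1.
Proof.
move=> g0; suff [-> //] : iter N nabla g 1 = g 1 /\
    forall t, t <= 0 -> iter N nabla g t = 0.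
elim: N => [|N [IH1 IH0]]; first by split.
split=> [|t t0]; first by rewrite nablanS IH1 IH0 ?subrr// subr0.
by rewrite nablanS !IH0 ?subrr//; lra.
Qed.

(** [t |-> |t| ^ (odd)] is no polynomial: a difference across its kink sees
    twice the jump that separates it from [- t ^ (odd)]. *)
Lemma nablan_abs_exp N a k : odd a -> (a + k < N)%N ->
  iter N nabla (fun t => `|t| ^+ a * t ^+ k) 1 = 2.
Proof.
move=> oa akN.
pose g t : R := `|t| ^+ a * t ^+ k + t ^+ (a + k).
have -> : iter N nabla (fun t => `|t| ^+ a * t ^+ k) 1
        = iter N nabla (fun t => g t + (-1) * t ^+ (a + k)) 1.
  by apply: eq_nablan => t; rewrite /g; ring.
rewrite nablanD nablanZ nablan_exp // mulr0 addr0 nablan_at1.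
  by rewrite /g normr1 !expr1n mulr1.
move=> t t0; rewrite /g ler0_norm // exprNn -signr_odd oa exprD expr1; ring.
Qed.

(** The cardinal B-spline of order [n + 2], up to the factor [(n + 1)!]. *)
Definition bspline n t : R := iter n.+2 nabla (fun x => Num.max 0 x ^+ n.+1) t.

(** The recursion of Cox and de Boor: the Leibniz rule applied to
    [x_+ ^ (n + 2) = x * x_+ ^ (n + 1)]. *)
Lemma bsplineS n t :
  bspline n.+1 t = t * bspline n t + (n.+3%:R - t) * bspline n (t - 1).
Proof.
rewrite /bspline.
have -> : iter n.+3 nabla (fun x => Num.max 0 x ^+ n.+2) t
        = iter n.+3 nabla (fun x => x * Num.max 0 x ^+ n.+1) t.
  apply: eq_nablan => x; rewrite [in LHS]exprS.
  by case: (lerP 0 x) => // _; rewrite expr0n /= !mulr0.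
rewrite nablan_id nablanS; ring.
Qed.

(** Inside the support of the left-hand side, both weights of the recursion
    are positive and one of the two splines of lower order does not vanish. *)
Lemma bspline_pos n t :
  (bspline n t = 0 \/ 0 < t < n.+2%:R) /\ (0 < t < n.+2%:R -> 0 < bspline n t).
Proof.
elim: n t => [|n IHn] t.
  rewrite /bspline /= /nabla !expr1.
  case: (lerP 0 t) => [t0|t0]; last first.
    have [-> ->] : Num.max 0 (t - 1) = 0 /\ Num.max 0 (t - 1 - 1) = 0.
      by split; apply/max_idPl; lra.
    by split; [left; lra | lra].
  case: (lerP 0 (t - 1)) => [t1|t1]; last first.
    have -> : Num.max 0 (t - 1 - 1) = 0 by apply/max_idPl; lra.
    split; last lra.
    have [->|tn0] := eqVneq t 0; [left; lra | right].
    by apply/andP; split; [rewrite lt_def tn0 | lra].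
  by case: (lerP 0 (t - 1 - 1)) => t2; split; lra.
have [nz pos] := IHn t; have [nz1 pos1] := IHn (t - 1).
have nnE : n.+3%:R = n.+2%:R + 1 :> R by rewrite natr1.
have n2 : 1 < n.+2%:R :> R by rewrite ltr1n.
have bge s : 0 <= bspline n s.
  by have [[-> //|/[swap] /[apply] /ltW]] := IHn s.
rewrite bsplineS nnE; split.
  case: (lerP t 0) => [t0|t0].
    left; case: nz => [->|]; last lra.
    case: nz1 => [->|]; last lra.
    by rewrite !mulr0 addr0.
  case: (ltrP t (n.+2%:R + 1)) => [tn|tn]; first by right; lra.
  left; case: nz => [->|]; last lra.
  case: nz1 => [->|]; last lra.
  by rewrite !mulr0 addr0.
case/andP=> t0 tn; case: (ltrP t n.+2%:R) => [tn2|tn2].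
  apply: ltr_wpDr; first by rewrite mulr_ge0 ?bge //; lra.
  by rewrite mulr_gt0 // pos // t0.
apply: ltr_wpDl; first by rewrite mulr_ge0 ?bge //; lra.
by apply: mulr_gt0; [lra | apply: pos1; apply/andP; split; lra].
Qed.

(** As [|t| ^ (2n + 1) = 2 t_+ ^ (2n + 1) - t ^ (2n + 1)] and the difference
    kills the polynomial, this is twice the central value of a B-spline. *)
Lemma nabla2n_abs_pos n :
  0 < iter n.+1.*2 nabla (fun t => `|t| ^+ n.*2.+1) n.+1%:R.
Proof.
have -> : iter n.+1.*2 nabla (fun t => `|t| ^+ n.*2.+1) n.+1%:R
   = iter n.+1.*2 nabla
      (fun t => 2 * Num.max 0 t ^+ n.*2.+1 + (-1) * t ^+ n.*2.+1) n.+1%:R.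
  apply: eq_nablan => t; case: (lerP 0 t) => t0.
    by rewrite ger0_norm //; ring.
  rewrite ltr0_norm // expr0n mulr0 add0r exprNn -signr_odd /= odd_double expr1.
  by [].
rewrite nablanD !nablanZ nablan_exp ?doubleS // mulr0 addr0 mulr_gt0 //.
rewrite -/(bspline n.*2 n.+1%:R).
have [_] := bspline_pos n.*2 n.+1%:R; apply.
by rewrite ltr0n /= ltr_nat -doubleS -addnn -[X in (X < _)%N]addn0 ltn_add2l.
Qed.

End Differences.

Arguments nabla {R} g t.

(** * Finitely supported signed measures *)

Section Measures.
Variable R : realType.
Implicit Types (T U : Type).

(** A list of weighted points stands for the measure that it sums up to. *)
Definition sint T (mu : seq (R * T)) (g : T -> R) : R :=
  \sum_(p <- mu) p.1 * g p.2.

Definition push T U (h : T -> U) (mu : seq (R * T)) : seq (R * U) :=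
  [seq (p.1, h p.2) | p <- mu].

Definition wscale T (c : R) (mu : seq (R * T)) : seq (R * T) :=
  [seq (c * p.1, p.2) | p <- mu].

Definition bil T (K : T -> T -> R) (mu nu : seq (R * T)) : R :=
  sint mu (fun x => sint nu (K x)).

Lemma sint_cat T (mu nu : seq (R * T)) g :
  sint (mu ++ nu) g = sint mu g + sint nu g.
Proof. by rewrite /sint big_cat. Qed.

Lemma sint_push T U (h : T -> U) mu g : sint (push h mu) g = sint mu (g \o h).
Proof. by rewrite /sint big_map. Qed.

Lemma sint_wscale T c (mu : seq (R * T)) g : sint (wscale c mu) g = c * sint mu g.
Proof.
by rewrite /sint big_map mulr_sumr; apply: eq_bigr => p _ /=; rewrite mulrA.
Qed.

Lemma eq_sint T (mu : seq (R * T)) g h : g =1 h -> sint mu g = sint mu h.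
Proof. by move=> gh; apply: eq_bigr => p _; rewrite gh. Qed.

Lemma sintD T (mu : seq (R * T)) g h :
  sint mu (fun x => g x + h x) = sint mu g + sint mu h.
Proof. by rewrite /sint -big_split; apply: eq_bigr => p _; rewrite mulrDr. Qed.

Lemma sintZ T (mu : seq (R * T)) c g :
  sint mu (fun x => c * g x) = c * sint mu g.
Proof. by rewrite /sint mulr_sumr; apply: eq_bigr => p _; rewrite mulrCA. Qed.

Lemma sintZr T (mu : seq (R * T)) c g :
  sint mu (fun x => g x * c) = sint mu g * c.
Proof. by rewrite mulrC -sintZ; apply: eq_sint => x; rewrite mulrC. Qed.

Lemma sint0 T (mu : seq (R * T)) : sint mu (fun=> 0) = 0.
Proof. by rewrite /sint big1 // => p _; rewrite mulr0. Qed.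

Lemma sint_sum T I (r : seq I) (P : pred I) (mu : seq (R * T)) (F : I -> T -> R) :
  sint mu (fun x => \sum_(i <- r | P i) F i x) = \sum_(i <- r | P i) sint mu (F i).
Proof.
by rewrite /sint exchange_big; apply: eq_bigr => p _; rewrite mulr_sumr.
Qed.

Lemma exchange_sint T U (mu : seq (R * T)) (nu : seq (R * U)) K :
  sint mu (fun x => sint nu (K x)) = sint nu (fun y => sint mu (K^~ y)).
Proof.
rewrite sint_sum; apply: eq_bigr => p _.
by rewrite -sintZ; apply: eq_sint.
Qed.

Lemma sint_flatten T I (r : seq I) (F : I -> seq (R * T)) g :
  sint (flatten [seq F i | i <- r]) g = \sum_(i <- r) sint (F i) g.
Proof.
elim: r => [|i r IHr]; first by rewrite /sint !big_nil.
by rewrite /= sint_cat IHr big_cons.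
Qed.

Lemma bil_cat T (K : T -> T -> R) mu nu : (forall x y, K x y = K y x) ->
  bil K (mu ++ nu) (mu ++ nu) = bil K mu mu + 2 * bil K mu nu + bil K nu nu.
Proof.
move=> Ksym; rewrite /bil sint_cat.
have E m : sint m (fun x => sint (mu ++ nu) (K x))
    = sint m (fun x => sint mu (K x)) + sint m (fun x => sint nu (K x)).
  by rewrite -sintD; apply: eq_sint => x; rewrite sint_cat.
rewrite !E [sint nu (fun x => sint mu (K x))]exchange_sint.
have -> : sint mu (fun x => sint nu (K^~ x)) = sint mu (fun x => sint nu (K x)).
  by apply: eq_sint => x; apply: eq_sint => y; rewrite Ksym.
ring.
Qed.

Lemma bil_wscaler T (K : T -> T -> R) mu nu c :
  bil K mu (wscale c nu) = c * bil K mu nu.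
Proof. by rewrite /bil -sintZ; apply: eq_sint => x; rewrite sint_wscale. Qed.

Lemma bil_wscale T (K : T -> T -> R) mu nu c b :
  bil K (wscale c mu) (wscale b nu) = c * b * bil K mu nu.
Proof. by rewrite {1}/bil sint_wscale -/(bil _ _ _) bil_wscaler mulrA. Qed.

Lemma bil_push T U (h : T -> U) (K : U -> U -> R) mu nu :
  bil K (push h mu) (push h nu) = bil (fun x y => K (h x) (h y)) mu nu.
Proof.
by rewrite /bil sint_push; apply: eq_sint => x /=; rewrite sint_push.
Qed.

Lemma eq_bil T (K L : T -> T -> R) mu nu :
  (forall x y, K x y = L x y) -> bil K mu nu = bil L mu nu.
Proof. by move=> KL; apply: eq_sint => x; apply: eq_sint. Qed.

Lemma bilD T (K L : T -> T -> R) mu nu :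
  bil (fun x y => K x y + L x y) mu nu = bil K mu nu + bil L mu nu.
Proof. by rewrite /bil -sintD; apply: eq_sint => x; rewrite sintD. Qed.

Lemma bilZ T (K : T -> T -> R) mu nu c :
  bil (fun x y => c * K x y) mu nu = c * bil K mu nu.
Proof. by rewrite /bil -sintZ; apply: eq_sint => x; rewrite sintZ. Qed.

Lemma cvg_sint T V (F : set_system V) {FF : Filter F} (mu : seq (R * T))
    (g : V -> T -> R) (h : T -> R) :
  (forall x, g e x @[e --> F] --> h x) -> sint mu (g e) @[e --> F] --> sint mu h.
Proof.
move=> gh; apply: (@cvg_big _ _ _ _ _ _ _ _ mu
  (fun p e => p.1 * g e p.2) (fun p => p.1 * h p.2)) => [|p _].
  exact: add_continuous.
by apply: cvgM; [exact: cvg_cst | exact: gh].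
Qed.

(** Differences as measures, to be transported to lines of the space. *)
Lemma nabla_measure N t :
  exists nu : seq (R * R), forall g, sint nu g = iter N nabla g t.
Proof.
elim: N t => [|N IHN] t.
  by exists [:: (1, t)] => g; rewrite /sint big_seq1 mul1r.
have [nu nuE] := IHN t; have [nu1 nu1E] := IHN (t - 1).
exists (nu ++ wscale (-1) nu1) => g.
by rewrite sint_cat sint_wscale nuE nu1E mulN1r.
Qed.

(** Positive definiteness on distinct points extends to repeated points by
    summing the weights of equal points. *)
Lemma posdef_bil_ge0 d (kappa : 'rV[R]_d -> 'rV[R]_d -> R) mu :
  posdef_kernel kappa -> 0 <= bil kappa mu mu.
Proof.
move=> pd; set s := undup [seq p.2 | p <- mu].
pose w z : R := \sum_(p <- mu | p.2 == z) p.1.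
have sintE g : sint mu g = \sum_(z <- s) w z * g z.
  rewrite /w; under [RHS]eq_bigr do rewrite mulr_suml.
  rewrite (exchange_big_dep xpredT) //= /sint; apply: eq_big_seq => p pmu.
  rewrite (big_rem p.2) /=; last by rewrite mem_undup map_f.
  rewrite eqxx big1_seq ?addr0 // => z /andP[/eqP <-].
  by rewrite mem_rem_uniq ?undup_uniq // inE eqxx.
pose y (i : 'I_(size s)) := nth 0 s i.
have yinj : injective y.
  move=> i j /eqP; rewrite nth_uniq ?undup_uniq //.
  by move=> /eqP ij; apply: val_inj.
have [_] := pd _ y yinj.
move=> /(_ (\col_i w (y i))) pos.
pose u : 'cV[R]_(size s) := \col_i w (y i).
have -> : bil kappa mu mu
    = (u^T *m (\matrix_(i, j) kappa (y i) (y j)) *m u) 0 0.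
  rewrite /bil sintE (big_nth 0) big_mkord -mulmxA mxE; apply: eq_bigr => i _.
  rewrite !mxE sintE (big_nth 0) big_mkord; congr (_ * _).
  by apply: eq_bigr => j _; rewrite !mxE mulrC.
have [->|u0] := eqVneq u 0; first by rewrite mulmx0 mxE.
exact/ltW/pos.
Qed.

(** The degenerate case of the Cauchy-Schwarz inequality. *)
Lemma lin_quad_ge0 (q c : R) : (forall s, 0 <= 2 * s * q + s ^+ 2 * c) -> q = 0.
Proof.
move=> H; apply/eqP/negPn/negP => q0.
pose b := `|c| + 1.
have cb : c <= b by rewrite /b; have := ler_norm c; lra.
have b0 : 0 < b by rewrite /b; have := normr_ge0 c; lra.
have := H (- q / b); rewrite leNgt => /negP; apply.
have -> : 2 * (- q / b) * q + (- q / b) ^+ 2 * c = q ^+ 2 / b * (c / b - 2).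
  by field; rewrite gt_eqF.
rewrite pmulr_rlt0; last by rewrite divr_gt0 // exprn_even_gt0.
have : c / b <= 1 by rewrite ler_pdivrMr // mul1r.
lra.
Qed.

End Measures.

(** * Moments *)

Section Moments.
Variables (R : realType) (d : nat).
Implicit Types (x y z : 'rV[R]_d) (s : seq 'I_d) (mu nu : seq (R * 'rV[R]_d)).

(** Words of coordinates index the monomials, with repetition but with
    concatenation for product. *)
Definition mon s x : R := \prod_(l <- s) x 0 l.

Definition dot x y : R := \sum_l x 0 l * y 0 l.

Definition kills k mu : Prop :=
  forall s, (size s < k)%N -> sint mu (mon s) = 0.

Lemma mon_nil x : mon [::] x = 1. Proof. exact: big_nil. Qed.

Lemma mon_cons l s x : mon (l :: s) x = x 0 l * mon s x.
Proof. exact: big_cons. Qed.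

Lemma mon_scale s c x : mon s (c *: x) = c ^+ size s * mon s x.
Proof.
elim: s => [|l s IHs]; first by rewrite !mon_nil mulr1.
by rewrite !mon_cons IHs mxE /= exprS; ring.
Qed.

Lemma dotC x y : dot x y = dot y x.
Proof. by apply: eq_bigr => l _; rewrite mulrC. Qed.

Lemma dotZl c x y : dot (c *: x) y = c * dot x y.
Proof. by rewrite /dot mulr_sumr; apply: eq_bigr => l _; rewrite mxE mulrA. Qed.

Lemma dotZr c x y : dot x (c *: y) = c * dot x y.
Proof. by rewrite dotC dotZl dotC. Qed.

Lemma dotBB x y : dot (x - y) (x - y) = dot x x - 2 * dot x y + dot y y.
Proof.
rewrite /dot mulr_sumr -sumrB -big_split; apply: eq_bigr => l _ /=.
rewrite !mxE; ring.
Qed.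

Lemma dot_ge0 x : 0 <= dot x x.
Proof. by apply: sumr_ge0 => l _; rewrite -expr2 sqr_ge0. Qed.

Lemma dot_eq0 x : (dot x x == 0) = (x == 0).
Proof.
apply/eqP/eqP => [x0|->]; last by rewrite /dot big1 // => l _; rewrite mxE mul0r.
apply/rowP => l; rewrite mxE; apply/eqP; rewrite -sqrf_eq0 expr2; apply/eqP.
by apply: (psumr_eq0P _ x0) => // i _; rewrite -expr2 sqr_ge0.
Qed.

Lemma l2normE x : l2norm x = Num.sqrt (dot x x).
Proof. by congr Num.sqrt; apply: eq_bigr => l _; rewrite expr2. Qed.

Lemma l2norm_sqr x : l2norm x ^+ 2 = dot x x.
Proof. by rewrite l2normE sqr_sqrtr // dot_ge0. Qed.

Lemma l2norm_eq0 x : (l2norm x == 0) = (x == 0).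
Proof. by rewrite -sqrf_eq0 l2norm_sqr dot_eq0. Qed.

Lemma l2normZ c x : l2norm (c *: x) = `|c| * l2norm x.
Proof.
by rewrite !l2normE dotZl dotZr mulrA -expr2 sqrtrM ?sqr_ge0 // sqrtr_sqr.
Qed.

Lemma l2norm_subC x y : l2norm (x - y) = l2norm (y - x).
Proof. by rewrite -opprB -scaleN1r l2normZ normrN1 mul1r. Qed.

(** The integrand expands into monomials of degree [2a + b]. *)
Lemma sint_hom j mu y a b : (forall s, size s = j -> sint mu (mon s) = 0) ->
  (2 * a + b)%N = j -> sint mu (fun z => dot z z ^+ a * dot y z ^+ b) = 0.
Proof.
move=> mu0 abj.
suff H s : (size s + (2 * a + b))%N = j ->
    sint mu (fun z => mon s z * (dot z z ^+ a * dot y z ^+ b)) = 0.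
  rewrite -(H [::] abj); apply: eq_sint => z.
  by rewrite mon_nil mul1r.
elim: a s {abj} => [|a IHa] s; last first.
  move=> sz; transitivity (\sum_(l < d) sint mu (fun z =>
      mon [:: l, l & s] z * (dot z z ^+ a * dot y z ^+ b))).
    rewrite -sint_sum; apply: eq_sint => z; rewrite exprS {1}/dot.
    rewrite !mulr_suml mulr_sumr; apply: eq_bigr => l _; rewrite !mon_cons; ring.
  by apply: big1 => l _; apply: IHa; rewrite /=; lia.
elim: b s => [|b IHb] s sz.
  rewrite -(mu0 s); last by move: sz; rewrite !addn0.
  by apply: eq_sint => z; rewrite !mulr1.
transitivity (\sum_(l < d) y 0 l * sint mu (fun z =>
    mon (l :: s) z * (dot z z ^+ 0 * dot y z ^+ b))).
  under eq_bigr do rewrite -sintZ.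
  rewrite -sint_sum; apply: eq_sint => z.
  rewrite exprS {2}/dot mulr_suml !mulr_sumr; apply: eq_bigr => l _.
  rewrite mon_cons; ring.
by apply: big1 => l _; rewrite IHb ?mulr0 //=; lia.
Qed.

(** The Schur powers of the Gram kernel are positive, each being a sum of
    squares of moments. *)
Lemma bil_dot_ge0 mu (g : 'rV[R]_d -> R) b :
  0 <= bil (fun y z => g y * g z * dot y z ^+ b) mu mu.
Proof.
elim: b g => [|b IHb] g.
  have -> : bil (fun y z => g y * g z * dot y z ^+ 0) mu mu = sint mu g ^+ 2.
    rewrite expr2 -[RHS]sintZr; apply: eq_sint => y.
    by rewrite -sintZ; apply: eq_sint => z; rewrite expr0 mulr1.
  exact: sqr_ge0.
have -> : bil (fun y z => g y * g z * dot y z ^+ b.+1) mu mu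
  = \sum_l bil (fun y z => (g y * y 0 l) * (g z * z 0 l) * dot y z ^+ b) mu mu.
  rewrite -sint_sum; apply: eq_sint => y; rewrite -sint_sum; apply: eq_sint => z.
  rewrite exprS {1}/dot mulr_suml mulr_sumr; apply: eq_bigr => l _; ring.
by apply: sumr_ge0 => l _; apply: (IHb (fun y => g y * y 0 l)).
Qed.

(** The square of a single nonzero moment is one of the summands. *)
Lemma bil_dot_gt0 mu s : sint mu (mon s) != 0 ->
  0 < bil (fun y z => dot y z ^+ size s) mu mu.
Proof.
suff H (g : 'rV[R]_d -> R) : sint mu (fun x => g x * mon s x) != 0 ->
    0 < bil (fun y z => g y * g z * dot y z ^+ size s) mu mu.
  move=> m0; rewrite (eq_bil _ _ (L := fun y z => 1 * 1 * dot y z ^+ size s)).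
    apply: (H (fun=> 1)); rewrite (eq_sint _ (h := mon s)) // => x.
    by rewrite mul1r.
  by move=> x y; rewrite !mul1r.
elim: s g => [|l s IHs] g m0.
  have -> : bil (fun y z => g y * g z * dot y z ^+ 0) mu mu = sint mu g ^+ 2.
    rewrite expr2 -[RHS]sintZr; apply: eq_sint => y.
    by rewrite -sintZ; apply: eq_sint => z; rewrite expr0 mulr1.
  rewrite exprn_even_gt0 //=; rewrite (eq_sint _ (h := g)) // in m0 => x.
  by rewrite mon_nil mulr1.
have -> : bil (fun y z => g y * g z * dot y z ^+ (size s).+1) mu mu
  = \sum_l bil (fun y z => (g y * y 0 l) * (g z * z 0 l) * dot y z ^+ size s)
             mu mu.
  rewrite -sint_sum; apply: eq_sint => y; rewrite -sint_sum; apply: eq_sint => z.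
  rewrite exprS {1}/dot mulr_suml mulr_sumr; apply: eq_bigr => k _; ring.
rewrite (bigD1 l) //=; apply: ltr_wpDr.
  by apply: sumr_ge0 => k _; apply: (bil_dot_ge0 mu (fun y => g y * y 0 k)).
apply: (IHs (fun y => g y * y 0 l)); rewrite (eq_sint _ (h := fun x => g x * mon (l :: s) x)) //.
by move=> x; rewrite mon_cons mulrA.
Qed.

(** Homogeneous components: doubling multiplies the moments of degree [l] by
    [2 ^ l], so the operators [2_* - 2 ^ l] remove the unwanted degrees. *)
Lemma moment_component M j mu : exists nu, forall s, (size s <= M)%N ->
  sint nu (mon s) = (size s == j)%:R * sint mu (mon s).
Proof.
suff H (ls : seq nat) : j \notin ls -> exists nu, exists chi : nat -> R,
    [/\ chi j = 1, forall l, l \in ls -> chi l = 0 &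
        forall s, sint nu (mon s) = chi (size s) * sint mu (mon s)].
  have [|nu [chi [chij chi0 nuE]]] := H [seq l <- iota 0 M.+1 | l != j].
    by rewrite mem_filter eqxx.
  exists nu => s sM; rewrite nuE; case: (eqVneq (size s) j) => [->|sj].
    by rewrite chij.
  by rewrite chi0 // mem_filter sj mem_iota.
elim: ls => [|l ls IHls] jls.
  by exists mu, (fun=> 1); split => // s; rewrite mul1r.
move: jls; rewrite inE negb_or => /andP[jl jls].
have [nu [chi [chij chi0 nuE]]] := IHls jls.
have jl0 : 2 ^+ j - 2 ^+ l != 0 :> R.
  by rewrite subr_eq0 -!natrX eqr_nat eqn_exp2l.
pose c : R := (2 ^+ j - 2 ^+ l)^-1.
exists (wscale c (push (fun x => 2 *: x) nu ++ wscale (- 2 ^+ l) nu)).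
exists (fun i => c * (2 ^+ i - 2 ^+ l) * chi i); split=> [|i|s].
- by rewrite chij mulr1 mulVf.
- by rewrite inE => /orP[/eqP->|/chi0->]; rewrite ?subrr ?mulr0 ?mul0r.
rewrite sint_wscale sint_cat sint_push sint_wscale.
rewrite (eq_sint _ (h := fun x => 2 ^+ size s * mon s x)); last first.
  by move=> x /=; rewrite mon_scale.
rewrite sintZ nuE; ring.
Qed.

(** The even powers of the distance are polynomials; a term of the list is a
    coefficient and a pair of monomials, one for each of the two points. *)
Lemma even_power_terms k :
  exists T : seq (R * (seq 'I_d * seq 'I_d)),
    (forall p, p \in T -> (size p.2.1 + size p.2.2)%N = (2 * k)%N) /\
    (forall x y, l2norm (x - y) ^+ (2 * k)
       = \sum_(p <- T) p.1 * (mon p.2.1 x * mon p.2.2 y)).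
Proof.
elim: k => [|k [T [sT TE]]].
  exists [:: (1, ([::], [::]))]; split=> [p|x y]; first by rewrite inE => /eqP->.
  by rewrite big_seq1 !mon_nil !mul1r.
pose step (p : R * (seq 'I_d * seq 'I_d)) (l : 'I_d) :=
  [:: (p.1, ([:: l, l & p.2.1], p.2.2)); (-2 * p.1, (l :: p.2.1, l :: p.2.2));
      (p.1, (p.2.1, [:: l, l & p.2.2]))].
exists (flatten [seq flatten [seq step p l | l <- index_enum 'I_d] | p <- T]).
split=> [q /flatten_mapP[p pT /flatten_mapP[l _]]|x y].
  by rewrite !inE => /or3P[] /eqP->; rewrite mulnS -(sT _ pT) /= ?addnS.
rewrite big_flatten big_map mulnS exprD TE l2norm_sqr mulr_sumr.
apply: eq_bigr => p _; rewrite big_flatten big_map /dot mulr_suml.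
apply: eq_bigr => l _; rewrite !big_cons big_nil !mon_cons /= !mxE; ring.
Qed.

End Moments.

(** * Limits at the right of zero *)

Section RightLimits.
Variable R : realType.

Lemma cvg_right_id : (e : R) @[e --> (0 : R)^'+] --> (0 : R).
Proof. by apply: cvg_within_filter; exact: cvg_id. Qed.

Lemma cvg_eql T (F : set_system T) (g : T -> R) (l l' : R) :
  g x @[x --> F] --> l -> l = l' -> g x @[x --> F] --> l'.
Proof. by move=> gl <-. Qed.

Lemma cvg_right_idM (D : R) : e * D @[e --> (0 : R)^'+] --> 0.
Proof. by have := @cvgMr_tmp _ _ _ _ id 0 D cvg_right_id; rewrite mul0r; apply. Qed.

Lemma cvgX T (F : set_system T) {FF : Filter F} (g : T -> R) (l : R) k :
  g e @[e --> F] --> l -> g e ^+ k @[e --> F] --> l ^+ k.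
Proof.
move=> gl; elim: k => [|k IHk]; first exact: cvg_cst.
rewrite exprS; under eq_cvg do rewrite exprS.
exact: cvgM.
Qed.

Lemma cvg_right_expB k i : (k <= i)%N ->
  e ^- k * e ^+ i @[e --> (0 : R)^'+] --> ((i == k)%:R : R).
Proof.
move=> ki; apply: (@cvg_trans _ (e ^+ (i - k) @[e --> (0 : R)^'+])).
  apply: near_eq_cvg; near=> e.
  have e0 : 0 < e by near: e; exact: nbhs_right_gt.
  by rewrite -{2}(subnK ki) exprD mulrCA mulVf ?mulr1 // expf_neq0 // gt_eqF.
have -> : (i == k)%:R = 0 ^+ (i - k) :> R by rewrite expr0n subn_eq0 eqn_leq ki andbT.
apply: cvgX; exact: cvg_right_id.
Unshelve. all: by end_near. Qed.

Lemma right_limit_ge0 (g : R -> R) l :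
  (forall e, 0 < e -> 0 <= g e) -> g e @[e --> (0 : R)^'+] --> l -> 0 <= l.
Proof.
move=> g0 gl; apply: (cvgr_to_ge gl); near=> e; apply: g0.
by near: e; exact: nbhs_right_gt.
Unshelve. all: by end_near. Qed.

(** The terms are bounded at some point of convergence, so that the tail is
    dominated by a geometric series at points half as far from 0. *)
Lemma power_series_tail (f : R -> R) (a : nat -> R) N : power_series_at0 f a ->
  exists C, exists2 b, 0 < b & forall t, `|t| <= b ->
    `|f t - \sum_(i < N) a i * t ^+ i| <= C * `|t| ^+ N.
Proof.
move=> /nbhs_ballP[e /= e0 fe].
have [t0 t00 t0e] : exists2 t0, 0 < t0 & t0 < e by exists (e / 2); lra.
have fcvg t : `|t| < e -> pseries a t n @[n --> \oo] --> f t.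
  by move=> te; apply: fe; rewrite /ball /= sub0r normrN.
have : cvgn (series (fun i => a i * t0 ^+ i)).
  apply/cvg_ex; exists (f t0); apply: fcvg.
  by rewrite gtr0_norm.
move=> /cvg_series_bounded[M0 [_ /(_ (M0 + 1))]].
set M := M0 + 1 => HM.
have {}HM i : `|a i * t0 ^+ i| <= M by apply: HM => //; rewrite /M; lra.
exists (2 * M * t0 ^- N), (t0 / 2); first by rewrite divr_gt0.
move=> t tt0; pose q := `|t| / t0.
have q0 : 0 <= q by rewrite divr_ge0 // ltW.
have q1 : q <= 2^-1 by rewrite ler_pdivrMr // mulrC.
have M_ge0 : 0 <= M := le_trans (normr_ge0 _) (HM 0%N).
have termE i : `|a i * t ^+ i| <= M * q ^+ i.
  have -> : `|a i * t ^+ i| = `|a i * t0 ^+ i| * q ^+ i.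
    rewrite !normrM !normrX (gtr0_norm t00) -mulrA -exprMn.
    by rewrite [t0 * q]mulrC divfK // gt_eqF.
  by rewrite ler_wpM2r ?exprn_ge0.
have geo m : \sum_(i < m) q ^+ i <= 2.
  have q1' : 0 < 1 - q by lra.
  have := subrX1 q m; set S := \sum_(i < m) _ => E.
  have S0 : 0 <= S by apply: sumr_ge0 => i _; rewrite exprn_ge0.
  have qm : 0 <= q ^+ m by rewrite exprn_ge0.
  rewrite -(ler_pM2l q1') (_ : (1 - q) * S = 1 - q ^+ m); last by lra.
  by lra.
have -> : 2 * M * t0 ^- N * `|t| ^+ N = 2 * M * q ^+ N.
  by rewrite /q expr_div_n; ring.
have lim : `|pseries a t n - \sum_(i < N) a i * t ^+ i| @[n --> \oo]
           --> `|f t - \sum_(i < N) a i * t ^+ i|.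
  apply: cvg_norm; apply: cvgB; last exact: cvg_cst.
  apply: fcvg; apply: le_lt_trans tt0 _; lra.
apply: (cvgr_to_le lim); near=> n.
have Nn : (N <= n)%N by near: n; exact: nbhs_infty_ge.
rewrite /pseries /series /= -(big_mkord xpredT (fun i => a i * t ^+ i)).
rewrite (big_cat_nat (leq0n N) Nn) /=. rewrite [_ - _]addrC addKr -{1}[N]add0n big_addn big_mkord.
apply: le_trans (ler_norm_sum _ _ _) _.
apply: (@le_trans _ _ (\sum_(i < n - N) M * q ^+ N * q ^+ i)).
  apply: ler_sum => i _; apply: le_trans (termE _) _.
  by rewrite exprD -mulrA [q ^+ i * _]mulrC.
rewrite -mulr_sumr -[leRHS]mulrA [leRHS]mulrC ler_wpM2l //.
by rewrite mulr_ge0 ?exprn_ge0.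
Unshelve. all: by end_near. Qed.

Lemma power_series_coef_cvg (f : R -> R) (a : nat -> R) N t :
  power_series_at0 f a ->
  e ^- N * (f (e * t) - \sum_(i < N) a i * (e * t) ^+ i) @[e --> (0 : R)^'+]
    --> a N * t ^+ N.
Proof.
move=> /(power_series_tail N.+1)[C [b b0 fb]].
pose g e := e ^- N * (f (e * t) - \sum_(i < N.+1) a i * (e * t) ^+ i).
apply: (@cvg_trans _ (g e + a N * t ^+ N @[e --> (0 : R)^'+])).
  apply: near_eq_cvg; near=> e.
  have e0 : 0 < e by near: e; exact: nbhs_right_gt.
  rewrite /g big_ord_recr /= exprMn.
  have : e ^+ N != 0 by rewrite expf_neq0 // gt_eqF.
  by move: (e ^+ N) => u u0; field.
suff g0 : g e @[e --> (0 : R)^'+] --> (0 : R).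
  have := @cvgD _ _ _ _ _ g (fun=> a N * t ^+ N) _ _ g0 (cvg_cst _).
  by rewrite add0r; apply.
apply/norm_cvg0P; pose D := C * `|t| ^+ N.+1.
apply: (@squeeze_cvgr _ _ _ _ (fun=> 0) (fun e => e * D)); last 2 first.
- exact: cvg_cst.
- exact: cvg_right_idM.
near=> e.
have e0 : 0 < e by near: e; exact: nbhs_right_gt.
have eb : e <= b / (`|t| + 1).
  by near: e; apply: nbhs_right_le; rewrite divr_gt0 // ltr_wpDl.
rewrite normr_ge0 /= /g normrM normfV normrX (gtr0_norm e0).
rewrite mulrC ler_pdivrMr ?exprn_gt0 //.
have := fb (e * t); rewrite normrM (gtr0_norm e0) => H.
apply: le_trans (H _) _.
  apply: (@le_trans _ _ (e * (`|t| + 1))).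
    by rewrite ler_pM2l // lerDl.
  by rewrite -ler_pdivlMr // ltr_wpDl.
by rewrite le_eqVlt; apply/orP; left; apply/eqP; rewrite /D exprMn !exprS; ring.
Unshelve. all: by end_near. Qed.

End RightLimits.

(** * Expansion of an odd power of the distance at a nonzero vector *)

Section BinomialSeries.
Variable R : realType.
Variable n : nat.

(** The coefficients of the series of [(1 + w) ^ (n + 1/2)]. *)
Fixpoint hbin (j : nat) : R :=
  if j is i.+1 then hbin i * (n%:R + 2^-1 - i%:R) / i.+1%:R else 1.

Lemma hbin_gt0 j : (j <= n.+1)%N -> 0 < hbin j.
Proof.
elim: j => [//|j IHj] jn; rewrite /= divr_gt0 // mulr_gt0 ?IHj //.
  exact: ltnW.
have : j%:R <= n%:R :> R by rewrite ler_nat -ltnS.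
lra.
Qed.

(** The truncated series is a square root of [(1 + X) ^ (2n + 1)] up to the
    order of truncation: both its square and that power solve the differential
    equation [(1 + X) p' = (2n + 1) p], the former up to that order. *)
Lemma hbin_sqr N : exists Z : {poly R},
  (\poly_(j < N.+1) hbin j) ^+ 2 - (1 + 'X) ^+ n.*2.+1 = 'X^(N.+1) * Z.
Proof.
pose s : R := n%:R + 2^-1; pose T := \poly_(j < N.+1) hbin j.
pose m : R := n.*2.+1%:R.
have ms : m = 2 * s by rewrite /m /s -natr1 -mul2n natrM; lra.
pose L (p : {poly R}) := (1 + 'X) * p^`() - m *: p.
have coefL p i : (L p)`_i = p`_i.+1 * i.+1%:R + p`_i * (i%:R - m).
  rewrite /L mulrDl mul1r coefB coefD coefXM coefZ !coef_deriv -mulr_natr.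
  case: i => [|i]; first by rewrite eqxx; ring.
  by rewrite -[_.-1]/i -[_ == _]/false -mulr_natr; ring.
have LT : (1 + 'X) * T^`() - s *: T = (hbin N * (N%:R - s)) *: 'X^N.
  have coefT i : T`_i = if (i < N.+1)%N then hbin i else 0 by rewrite coef_poly.
  apply/polyP => i; rewrite mulrDl mul1r coefB coefD coefXM !coefZ coefXn.
  rewrite !coef_deriv.
  have -> : (if i == 0%N then 0 else T`_i.-1.+1 *+ i.-1.+1) = T`_i * i%:R.
    by case: i => [|i]; rewrite ?mulr0 ?mulr_natr.
  rewrite !coefT.
  rewrite -mulr_natr !ltnS; case: (ltngtP i N) => [iN|iN|->] /=.
  - by rewrite mulr0 /= /s; field; rewrite ?natr1 ?nat1r pnatr_eq0.
  - ring.
  - ring.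
set E := T ^+ 2 - _; have LE : L E = 2 *: (T * ((hbin N * (N%:R - s)) *: 'X^N)).
  have MP : n.*2.+1%:R = m%:P :> {poly R} by rewrite /m rmorph_nat.
  have mP : m%:P = 2 * s%:P :> {poly R} by rewrite ms rmorphM /= rmorph_nat.
  rewrite -LT /L /E derivB !deriv_exp /= derivD derivC derivX add0r mul1r.
  rewrite -!mul_polyC -[_ *+ n.*2.+1]mulr_natr MP mP rmorph_nat expr1.
  by rewrite [_ ^+ n.*2.+1]exprS; move: ((1 + _) ^+ n.*2) => B; ring.
have E0 i : (i <= N)%N -> E`_i = 0.
  elim: i => [|i IHi] iN.
    rewrite -horner_coef0 hornerD hornerN !horner_exp hornerD hornerX hornerC.
    by rewrite addr0 horner_coef0 coef_poly /= !expr1n subrr.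
  have := coefL E i; rewrite IHi ?(ltnW iN) // mul0r addr0 LE -scalerAr.
  by rewrite !coefZ coefMXn iN !mulr0 mulr_natr => /esym/eqP; rewrite mulrn_eq0 => /eqP.
exists (drop_poly N.+1 E); rewrite -[LHS](poly_take_drop N.+1) [RHS]mulrC.
rewrite [take_poly _ _](_ : _ = 0) ?add0r //.
by apply/polyP => i; rewrite coef_take_poly coef0; case: ltnP => // /E0.
Qed.

End BinomialSeries.

Section Jets.
Variables (R : realType) (d n : nat).
Local Notation hbin := (hbin R n).
Implicit Types (x y z : 'rV[R]_d) (theta : seq (R * 'rV[R]_d)).

(** The square root [s] and the truncated series [t] satisfy
    [(s - t) (s + t) = O(w ^ (k + 1))], while [s + t] tends to 2. *)
Lemma hbin_cvg k (q : R -> R) (l : R) : q e @[e --> (0 : R)^'+] --> l ->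
  e ^- k * (Num.sqrt (1 + e * q e) ^+ n.*2.+1
            - \sum_(j < k.+1) hbin j * (e * q e) ^+ j) @[e --> (0 : R)^'+] --> (0 : R).
Proof.
move=> ql; have [Z ZE] := hbin_sqr R n k.
pose T := \poly_(j < k.+1) hbin j.
pose w e := e * q e; pose sg e := Num.sqrt (1 + w e) ^+ n.*2.+1.
have w0 : w e @[e --> (0 : R)^'+] --> (0 : R).
  by apply: (cvg_eql (cvgM (@cvg_right_id R) ql)); rewrite mul0r.
have pw p : p.[w e] @[e --> (0 : R)^'+] --> (p.[0] : R).
  exact: (@cvg_comp _ _ _ w (horner p) _ _ _ w0 (@continuous_horner _ p _)).
have sgl : sg e @[e --> (0 : R)^'+] --> (1 : R).
  have -> : 1 = Num.sqrt (1 + 0) ^+ n.*2.+1 :> R by rewrite addr0 sqrtr1 expr1n.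
  apply: cvgX.
  apply: (@cvg_comp _ _ _ (fun e => 1 + w e) (@Num.sqrt R) _ (nbhs (1 + 0 : R))).
    by apply: cvgD => //; exact: cvg_cst.
  exact: sqrt_continuous.
have T0 : T.[0] = 1 by rewrite horner_coef0 coef_poly.
have Tsl : T.[w e] + sg e @[e --> (0 : R)^'+] --> (2 : R).
  have -> : 2 = T.[0] + 1 :> R by rewrite T0.
  by apply: cvgD.
apply: (@cvg_trans _ (e * (- (q e ^+ k.+1 * Z.[w e] / (T.[w e] + sg e)))
                       @[e --> (0 : R)^'+])); last first.
  apply: (@cvg_eql _ _ _ _ (0 * - (l ^+ k.+1 * Z.[0] / 2))); last by rewrite mul0r.
  apply: cvgM; first exact: cvg_right_id.
  apply: cvgN; apply: cvgM; last exact: cvgV.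
  by apply: cvgM => //; exact: cvgX.
apply: near_eq_cvg; near=> e.
have e0 : 0 < e by near: e; exact: nbhs_right_gt.
have Ts0 : 0 < T.[w e] + sg e by near: e; exact: (cvgr_gt _ Tsl).
have w1 : 0 <= 1 + w e.
  apply: ltW; near: e; apply: (cvgr_gt (1 : R)) => //.
  by apply: (@cvg_eql _ _ _ _ (1 + 0)); [apply: cvgD => //; exact: cvg_cst | rewrite addr0].
have sg2 : sg e ^+ 2 = (1 + w e) ^+ n.*2.+1.
  by rewrite /sg -exprM mulnC exprM sqr_sqrtr.
have TE : T.[w e] = \sum_(j < k.+1) hbin j * w e ^+ j by rewrite horner_poly.
have := congr1 (horner^~ (w e)) ZE.
rewrite hornerD hornerN !horner_exp hornerD hornerC hornerX hornerM hornerXn.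
rewrite -/T -sg2 -TE => E.
have {}E : sg e - T.[w e] = - (w e ^+ k.+1 * Z.[w e] / (T.[w e] + sg e)).
  rewrite -E; field; exact: lt0r_neq0.
rewrite -/(w e) -/(sg e) E {1}/w exprMn [e ^+ k.+1]exprS.
have : e ^+ k != 0 by rewrite expf_neq0 // gt_eqF.
move: (e ^+ k) => u u0; field; rewrite u0 andbT; exact: lt0r_neq0.
Unshelve. all: by end_near. Qed.

(** The part of degree [k] in [z] of [|y - z| ^ (2n + 1)], cleared of the
    power [|y| ^ (2n + 1 - 2k)]. *)
Definition jet k y z : R :=
  \sum_(j < k.+1) \sum_(i < j.+1 | (i + j)%N == k)
    hbin j * 'C(j, i)%:R * dot y y ^+ i
      * (dot z z ^+ i * (- 2 * dot y z) ^+ (j - i)).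

Lemma jetZ k c y z : jet k (c *: y) z = c ^+ k * jet k y z.
Proof.
rewrite /jet [RHS]mulr_sumr; apply: eq_bigr => j _; rewrite [RHS]mulr_sumr.
apply: eq_bigr => i /eqP ijk; rewrite !dotZl dotZr.
have -> : c ^+ k = c ^+ (i + i + (j - i)).
  by rewrite -addnA subnKC -1?ltnS // ijk.
rewrite !exprD [- 2 * (c * _)]mulrCA !exprMn; ring.
Qed.

Lemma jet_sint_eq0 k y theta :
  (forall s, size s = k -> sint theta (mon s) = 0) -> sint theta (jet k y) = 0.
Proof.
move=> th0; rewrite sint_sum big1 // => j _; rewrite sint_sum big1 // => i ijk.
rewrite sintZ (eq_sint _ (h := fun z =>
  (- 2) ^+ (j - i) * (dot z z ^+ i * dot y z ^+ (j - i)))).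
  rewrite sintZ (sint_hom _ th0) ?mulr0 //.
  by rewrite mul2n -addnn -addnA subnKC -1?ltnS // (eqP ijk).
by move=> z; rewrite exprMn; ring.
Qed.

(** All terms of the jet kernel have the sign of [(-1) ^ k]: this uses that
    the first binomial coefficients of exponent [n + 1/2] are positive. *)
Lemma bil_jet_gt0 s theta : (size s <= n.+1)%N -> sint theta (mon s) != 0 ->
  0 < (-1) ^+ size s * bil (jet (size s)) theta theta.
Proof.
set k := size s => kn ths.
pose c j i := hbin j * 'C(j, i)%:R * 2 ^+ (j - i).
pose K i j y z := (dot y y ^+ i * dot z z ^+ i) * dot y z ^+ (j - i).
have -> : (-1) ^+ k * bil (jet k) theta theta
   = \sum_(j < k.+1) \sum_(i < j.+1 | (i + j)%N == k)
        c j i * bil (K i j) theta theta.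
  rewrite -bilZ {1}/bil.
  transitivity (sint theta (fun y => sint theta (fun z =>
     \sum_(j < k.+1) \sum_(i < j.+1 | (i + j)%N == k) c j i * K i j y z))).
    apply: eq_sint => y; apply: eq_sint => z; rewrite /jet [LHS]mulr_sumr.
    apply: eq_bigr => j _; rewrite [LHS]mulr_sumr; apply: eq_bigr => i /eqP ijk.
    have -> : (-1) ^+ k = (-1) ^+ (2 * i + (j - i)) :> R.
      by rewrite mul2n -addnn -addnA subnKC -1?ltnS // ijk.
    rewrite exprD exprM sqrrN expr1n expr1n mul1r /c /K.
    have -> : - 2 * dot y z = (-1) * (2 * dot y z) by ring.
    rewrite !exprMn; move: (signr_odd R (j - i)) => <-.
    by case: (odd _); rewrite ?expr0 ?expr1; ring.
  under eq_sint do rewrite sint_sum; rewrite sint_sum; apply: eq_bigr => j _.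
  under eq_sint do rewrite sint_sum; rewrite sint_sum; apply: eq_bigr => i _.
  exact: bilZ.
have c0 (j : 'I_k.+1) i : 0 <= c j i.
  rewrite /c !mulr_ge0 ?exprn_ge0 // ltW // hbin_gt0 //.
  by apply: leq_trans kn; rewrite -ltnS.
have K0 i j : 0 <= bil (K i j) theta theta.
  exact: (bil_dot_ge0 theta (fun y => dot y y ^+ i)).
have S0 (j : 'I_k.+1) :
    0 <= \sum_(i < j.+1 | (i + j)%N == k) c j i * bil (K i j) theta theta.
  by apply: sumr_ge0 => i _; rewrite mulr_ge0.
rewrite (bigD1 ord_max) //=; apply: ltr_wpDr.
  by apply: sumr_ge0 => j _; exact: S0.
rewrite (bigD1 ord0) //=; apply: ltr_wpDr.
  by apply: sumr_ge0 => i _; rewrite mulr_ge0 // (c0 ord_max).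
rewrite mulr_gt0 //; first by rewrite /c bin0 mulr1 mulr_gt0 ?exprn_gt0 ?hbin_gt0.
rewrite (eq_bil _ _ (L := fun y z => dot y z ^+ k)); first exact: bil_dot_gt0.
by move=> y z; rewrite /K !expr0 !mul1r subn0.
Qed.

(** In the expansion of the distance in powers of the scale, the terms of
    degree less than [k], which the division would make blow up, are
    polynomials that [theta] annihilates; those of degree more than [k] tend
    to 0. *)
Lemma jet_cvg k theta y : y != 0 -> kills k theta ->
  e ^- k * sint theta (fun z => l2norm (y - e *: z) ^+ n.*2.+1) @[e --> (0 : R)^'+]
    --> l2norm y ^+ n.*2.+1 * dot y y ^- k * sint theta (jet k y).
Proof.
move=> y0 thk; pose m := n.*2.+1; pose Y := dot y y.
have Y0 : 0 < Y by rewrite lt_def dot_eq0 y0 dot_ge0.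
pose q z e := (e * dot z z - 2 * dot y z) / Y.
pose S j i := sint theta (fun z => dot z z ^+ i * (- 2 * dot y z) ^+ (j - i)).
have SE0 j i : (i <= j)%N -> (i + j < k)%N -> S j i = 0.
  move=> ij ijk; rewrite /S (eq_sint _ (h := fun z =>
    (- 2) ^+ (j - i) * (dot z z ^+ i * dot y z ^+ (j - i)))).
    rewrite sintZ (@sint_hom _ _ (i + j)) ?mulr0 //.
      by move=> s sE; apply: thk; rewrite sE.
    by rewrite mul2n -addnn -addnA subnKC.
  by move=> z; rewrite exprMn; ring.
(* [1 + e q] is the ratio of the two squared distances. *)
have distE e z : l2norm (y - e *: z) = l2norm y * Num.sqrt (1 + e * q z e).
  rewrite !l2normE -sqrtrM ?dot_ge0 // dotBB !(dotZl, dotZr).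
  congr Num.sqrt; rewrite /q -/Y; field; exact: lt0r_neq0.
pose err z e := e ^- k * (Num.sqrt (1 + e * q z e) ^+ m
            - \sum_(j < k.+1) hbin j * (e * q z e) ^+ j).
pose main e := \sum_(j < k.+1) \sum_(i < j.+1)
   hbin j * 'C(j, i)%:R * Y ^- j * (e ^- k * e ^+ (i + j) * S j i).
have E e : e ^- k * sint theta (fun z => l2norm (y - e *: z) ^+ m)
         = l2norm y ^+ m * (main e + sint theta (err^~ e)).
  have -> : main e = sint theta (fun z =>
      e ^- k * \sum_(j < k.+1) hbin j * (e * q z e) ^+ j).
    rewrite sintZ sint_sum mulr_sumr; apply: eq_bigr => j _.
    rewrite /S; transitivity (\sum_(i < j.+1) e ^- k * sint theta (fun z =>
        hbin j * 'C(j, i)%:R * Y ^- j * e ^+ (i + j)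
          * (dot z z ^+ i * (- 2 * dot y z) ^+ (j - i)))).
      by apply: eq_bigr => i _; rewrite sintZ; ring.
    rewrite -mulr_sumr -sint_sum; congr (_ * _); apply: eq_sint => z.
    have -> : e * q z e = (- 2 * dot y z + e * dot z z) * (e / Y) by rewrite /q; ring.
    rewrite exprMn exprDn [X in _ = _ * X]mulr_suml [RHS]mulr_sumr; apply: eq_bigr => i _.
    rewrite -mulr_natr !exprMn exprVn exprD; ring.
  rewrite -sintD -!sintZ; apply: eq_sint => z.
  rewrite distE exprMn /err; ring.
rewrite -/m; under eq_cvg do rewrite E.
rewrite -mulrA; apply: cvgM; first exact: cvg_cst.
apply: (@cvg_eql _ _ _ _ (Y ^- k * sint theta (jet k y) + 0)); last by rewrite addr0.
apply: cvgD; last first.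
  apply: (@cvg_eql _ _ _ _ (sint theta (fun=> 0))); last exact: sint0.
  apply: cvg_sint => z.
  apply: (@hbin_cvg _ _ ((0 * dot z z - 2 * dot y z) / Y)).
  apply: cvgM; last exact: cvg_cst.
  apply: cvgB; last exact: cvg_cst.
  by apply: cvgM; [exact: cvg_right_id | exact: cvg_cst].
have -> : Y ^- k * sint theta (jet k y) = \sum_(j < k.+1) \sum_(i < j.+1)
   hbin j * 'C(j, i)%:R * Y ^- j * (((i + j)%N == k)%:R * S j i).
  rewrite sint_sum mulr_sumr; apply: eq_bigr => j _.
  rewrite sint_sum mulr_sumr big_mkcond; apply: eq_bigr => i _.
  case: eqP => [ijk|_] /=; last by rewrite mul0r mulr0.
  rewrite sintZ -/Y -/(S j i) mul1r.
  have -> : Y ^- k = (Y ^+ i)^-1 * Y ^- j by rewrite -invfM -exprD ijk.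
  have : Y ^+ i != 0 by rewrite expf_neq0 // lt0r_neq0.
  by move: (Y ^+ i) (Y ^- j) => u v u0; field.
apply: cvg_big => [|j _]; first exact: add_continuous.
apply: cvg_big => [|i _]; first exact: add_continuous.
apply: cvgM; first exact: cvg_cst.
case: (leqP k (i + j)) => ijk; last first.
  rewrite SE0 ?mulr0 -1?ltnS //; under eq_cvg do rewrite mulr0.
  exact: cvg_cst.
by apply: cvgM; [exact: cvg_right_expB | exact: cvg_cst].
Qed.

End Jets.

(** * The positivity that a positive definite radial kernel leaves behind *)

Section KernelLimit.
Variables (R : realType) (d n : nat) (f : R -> R) (a : nat -> R).
Implicit Types (x y z : 'rV[R]_d) (mu nu theta lam : seq (R * 'rV[R]_d)).
Local Notation m := n.*2.+1.

Definition distk x y : R := l2norm (x - y) ^+ m.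

(** The terms of even order at most [2n], which are polynomials in the two
    points, as opposed to the first odd one. *)
Definition evenk (e : R) x y : R :=
  \sum_(i < n.+1) a (2 * i)%N * (e * l2norm (x - y)) ^+ (2 * i).


Lemma sum_even_terms (g : nat -> R) k :
  (forall i, odd i -> (i < k.*2.+1)%N -> g i = 0) ->
  \sum_(i < k.*2.+1) g i = \sum_(i < k.+1) g (2 * i)%N.
Proof.
elim: k => [|k IHk] g0; first by rewrite !big_ord1.
rewrite doubleS big_ord_recr big_ord_recr /= IHk.
  by rewrite [RHS]big_ord_recr /= (g0 k.*2.+1) ?addr0 ?mul2n //= odd_double.
by move=> i oi ik; apply: g0 => //; apply: leq_trans ik _; rewrite doubleS; lia.
Qed.

Hypothesis odd0 : forall i, odd i -> (i < m)%N -> a i = 0.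
Hypothesis fseries : power_series_at0 f a.

(** The odd part of lowest order is the leading term of what is not even. *)
Lemma odd_part_cvg x y :
  e ^- m * (scaled_kernel f e x y - evenk e x y) @[e --> (0 : R)^'+]
    --> a m * distk x y.
Proof.
have := @power_series_coef_cvg _ f a m (l2norm (x - y)) fseries.
rewrite /scaled_kernel /evenk; under eq_cvg => e.
  rewrite (sum_even_terms (g := fun i => a i * (e * l2norm (x - y)) ^+ i)).
    over.
  by move=> i oi im; rewrite odd0 ?mul0r.
exact.
Qed.

Lemma even_terms : exists T : seq (R * (seq 'I_d * seq 'I_d)),
  (forall p, p \in T -> (size p.2.1 + size p.2.2 <= n.*2)%N) /\
  (forall e x y, evenk e x y = \sum_(p <- T)
     p.1 * e ^+ (size p.2.1 + size p.2.2) * (mon p.2.1 x * mon p.2.2 y)).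
Proof.
rewrite /evenk; elim: (n) => [|k [T [sT TE]]].
  exists [:: (a 0%N, ([::], [::]))]; split=> [p|e x y].
    by rewrite inE => /eqP->.
  by rewrite big_seq1 big_ord1 !mon_nil /= !mulr1.
have [U [sU UE]] := even_power_terms R d k.+1.
exists (T ++ [seq (a (2 * k.+1)%N * p.1, p.2) | p <- U]); split=> [p|e x y].
  rewrite mem_cat => /orP[/sT|/mapP[q /sU qU ->] /=].
    by move=> /leq_trans; apply; rewrite leq_double.
  by rewrite qU mul2n.
rewrite big_ord_recr big_cat big_map /= TE; congr (_ + _).
rewrite exprMn UE !mulr_sumr; apply: eq_big_seq => p /sU ->; ring.
Qed.

Hypothesis fpos : forall e mu, 0 < e -> 0 <= bil (scaled_kernel f e) mu mu.

(** A combination of measures that makes the even part vanish for all scales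
    lets the first odd term decide the sign of the kernel's form, in which the
    most singular measure dominates. *)
Lemma leading_form_ge0 k (theta : nat -> seq (R * 'rV[R]_d)) :
  let comb e := flatten [seq wscale (e ^- j) (theta j) | j <- iota 0 k.+1] in
  (forall e, 0 < e -> bil (evenk e) (comb e) (comb e) = 0) ->
  0 <= a m * bil distk (theta k) (theta k).
Proof.
move=> comb even0.
have combE e g : sint (comb e) g = \sum_(j < k.+1) e ^- j * sint (theta j) g.
  rewrite sint_flatten -[k.+1]subn0 -/(index_iota 0 k.+1) big_mkord.
  by apply: eq_bigr => j _; rewrite sint_wscale.
pose K e x y := e ^- m * (scaled_kernel f e x y - evenk e x y).
pose Q e := \sum_(j < k.+1) \sum_(i < k.+1)
   (e ^- j * e ^+ k) * (e ^- i * e ^+ k) * bil (K e) (theta j) (theta i).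
have QE e : 0 < e ->
    Q e = e ^+ k * e ^+ k * e ^- m * bil (scaled_kernel f e) (comb e) (comb e).
  move=> e0; have -> : bil (scaled_kernel f e) (comb e) (comb e)
      = bil (fun x y => scaled_kernel f e x y - evenk e x y) (comb e) (comb e).
    rewrite (eq_bil _ _ (L := fun x y =>
      (scaled_kernel f e x y - evenk e x y) + evenk e x y)).
      by rewrite bilD even0 ?addr0.
    by move=> x y; rewrite subrK.
  rewrite -mulrA -bilZ -/(K e) {1}/bil combE mulr_sumr; apply: eq_bigr => j _.
  under eq_sint do rewrite combE.
  rewrite sint_sum !mulr_sumr; apply: eq_bigr => i _.
  rewrite sintZ -/(bil _ _ _); ring.
apply: (@right_limit_ge0 _ Q) => [e e0|].
  rewrite QE // mulr_ge0 ?fpos // mulr_ge0 ?invr_ge0 //; last by rewrite exprn_ge0 ?ltW.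
  by rewrite -expr2 sqr_ge0.
have -> : a m * bil distk (theta k) (theta k) = \sum_(j < k.+1) \sum_(i < k.+1)
   (k == j)%:R * (k == i)%:R * bil (fun x y => a m * distk x y) (theta j) (theta i).
  rewrite (bigD1 ord_max) //= [X in _ + X]big1 ?addr0; last first.
    move=> j jk; apply: big1 => i _; rewrite [k == j]eq_sym.
    by rewrite -[(j : nat) == k]/(j == ord_max) (negPf jk) !mul0r.
  rewrite (bigD1 ord_max) //= big1 ?addr0; last first.
    move=> j jk; rewrite [k == j]eq_sym.
    by rewrite -[(j : nat) == k]/(j == ord_max) (negPf jk) mulr0 mul0r.
  by rewrite eqxx !mul1r bilZ.
apply: cvg_big => [|j _]; first exact: add_continuous.
apply: cvg_big => [|i _]; first exact: add_continuous.
apply: cvgM; first apply: cvgM.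
- by apply: cvg_right_expB; rewrite -ltnS.
- by apply: cvg_right_expB; rewrite -ltnS.
by apply: cvg_sint => x; apply: cvg_sint => y; exact: odd_part_cvg.
Qed.

Lemma bil_evenk T e mu nu :
  (forall e x y, evenk e x y = \sum_(p <- T)
     p.1 * e ^+ (size p.2.1 + size p.2.2) * (mon p.2.1 x * mon p.2.2 y)) ->
  bil (evenk e) mu nu = \sum_(p <- T)
    p.1 * e ^+ (size p.2.1 + size p.2.2)
      * (sint mu (mon p.2.1) * sint nu (mon p.2.2)).
Proof.
move=> T_even.
rewrite /bil; under eq_sint => x do under eq_sint => y do rewrite T_even.
under eq_sint => x do rewrite sint_sum.
rewrite sint_sum; apply: eq_bigr => p _.
under eq_sint => x do rewrite sintZ sintZ.
by rewrite sintZ sintZr.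
Qed.

(** Each term of the even part has a monomial of degree at most [n] in one of
    the two points, which [mu] annihilates. *)
Lemma distk_form_ge0 mu : kills n.+1 mu -> 0 <= a m * bil distk mu mu.
Proof.
move=> mu0; apply: (@leading_form_ge0 0 (fun=> mu)) => e e0.
have [T [T_deg T_even]] := even_terms.
rewrite /= cats0 bil_wscale (bil_evenk _ _ _ T_even) big1_seq ?mulr0 // => p /andP[_ /T_deg pT].
have [s1|s1] := leqP (size p.2.1) n; first by rewrite mu0 // mul0r mulr0.
rewrite (mu0 p.2.2) ?mulr0 // ltnS leqNgt; apply/negP => s2.
by have := leq_trans (leq_add s1 s2) pT; rewrite -addnn; lia.
Qed.

Lemma distkC x y : distk x y = distk y x.
Proof. by rewrite /distk l2norm_subC. Qed.

Hypothesis d_gt0 : (0 < d)%N.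
Let axis : 'rV[R]_d := delta_mx 0 (Ordinal d_gt0).

Lemma l2norm_axis : l2norm axis = 1.
Proof.
rewrite l2normE /dot (bigD1 (Ordinal d_gt0)) //= !mxE !eqxx mulr1.
by rewrite big1 ?addr0 ?sqrtr1 // => l ln; rewrite !mxE eqxx (negPf ln) mul0r.
Qed.

Lemma axis_neq0 : axis != 0.
Proof. by rewrite -l2norm_eq0 l2norm_axis oner_eq0. Qed.

Lemma kills_nabla N t (v : 'rV[R]_d) (nu : seq (R * R)) :
  (forall g, sint nu g = iter N nabla g t) -> kills N (push (fun c => c *: v) nu).
Proof.
move=> nuE s sN; rewrite sint_push.
rewrite (eq_sint _ (h := fun c => mon s v * c ^+ size s)); last first.
  by move=> c /=; rewrite mon_scale mulrC.
by rewrite sintZ nuE nablan_exp // mulr0.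
Qed.

Lemma kills_translate k c mu : kills k mu -> kills k (push (fun z => c + z) mu).
Proof.
move=> mu0 s sk; rewrite sint_push.
suff H s' : (size s + size s' < k)%N ->
    sint mu (fun z => mon s (c + z) * mon s' z) = 0.
  rewrite -(H [::]) ?addn0 //; apply: eq_sint => z.
  by rewrite mon_nil mulr1.
elim: s {sk} s' => [|l s IHs] s' sk.
  by rewrite -(mu0 s') //; apply: eq_sint => z; rewrite mon_nil mul1r.
rewrite (eq_sint _ (h := fun z => c 0 l * (mon s (c + z) * mon s' z)
    + mon s (c + z) * mon (l :: s') z)).
  rewrite sintD sintZ !IHs ?mulr0 ?addr0 //; first by rewrite addnS.
  exact: ltnW.
by move=> z; rewrite !mon_cons mxE; ring.
Qed.

Lemma kills_scale k c mu : kills k mu -> kills k (push (fun z => c *: z) mu).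
Proof.
move=> mu0 s sk; rewrite sint_push.
rewrite (eq_sint _ (h := fun z => c ^+ size s * mon s z)).
  by rewrite sintZ mu0 ?mulr0.
by move=> z /=; rewrite mon_scale.
Qed.

Lemma kills_leq k l mu : (k <= l)%N -> kills l mu -> kills k mu.
Proof. by move=> kl mu0 s sk; apply: mu0; exact: leq_trans kl. Qed.

Hypothesis am_neq0 : a m != 0.

(** The sign is read off a finite difference along a line, where the form is a
    value of a B-spline. *)
Lemma odd_coef_sign : 0 < (-1) ^+ n.+1 * a m.
Proof.
have [nu nuE] := nabla_measure n.+1 (0 : R).
have := distk_form_ge0 (kills_nabla axis nuE).
rewrite bil_push; pose g (t : R) : R := `|t| ^+ m.
have -> : bil (fun s t => distk (s *: axis) (t *: axis)) nu nu
        = (-1) ^+ n.+1 * iter n.+1.*2 nabla g n.+1%:R.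
  rewrite (eq_bil _ _ (L := fun s t => g (s - t))); last first.
    by move=> s t; rewrite /distk -scalerBl l2normZ l2norm_axis mulr1.
  rewrite /bil nuE; under eq_nablan => s do rewrite nuE nablan_reflect subr0.
  by rewrite nablanZ nablan_shift add0r -addnn iterD.
have := nabla2n_abs_pos R n; rewrite -/g; set b := iter _ _ _ _ => b0.
rewrite mulrA pmulr_lge0 // mulrC le_eqVlt => /orP[|//].
by rewrite eq_sym mulf_eq0 (negPf am_neq0) signr_eq0.
Qed.

(** Cauchy-Schwarz, for a form known to be positive. *)
Lemma distk_form_orthogonal lam nu : kills n.+1 lam -> kills n.+1 nu ->
  bil distk lam lam = 0 -> bil distk lam nu = 0.
Proof.
move=> lam0 nu0 form0; suff /eqP : a m * bil distk lam nu = 0.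
  by rewrite mulf_eq0 (negPf am_neq0) => /eqP.
apply: (@lin_quad_ge0 _ _ (a m * bil distk nu nu)) => s.
have : kills n.+1 (lam ++ wscale s nu).
  by move=> t tn; rewrite sint_cat sint_wscale lam0 // nu0 // mulr0 addr0.
move=> /distk_form_ge0; rewrite bil_cat; last exact: distkC.
by rewrite form0 bil_wscaler bil_wscale; congr (_ <= _); ring.
Qed.

(** If the form vanished at a nonzero measure, the potential of the measure
    would be annihilated by the same differences as a polynomial; it is
    singular at each point of the measure. *)
Lemma distk_form_definite N (x : 'I_N -> 'rV[R]_d) (u : 'I_N -> R) :
  injective x -> let lam := [seq (u i, x i) | i <- enum 'I_N] in
  kills n.+1 lam -> bil distk lam lam = 0 -> forall i, u i = 0.
Proof.
move=> xinj lam lam0 form0 i.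
have lamE g : sint lam g = \sum_l u l * g (x l).
  by rewrite /sint big_map big_enum.
(* The difference at 1 has the point 1 on one side of 0 and all others on the
   other side, so that it does not kill [|t| ^ m]. *)
have [nu nuE] := nabla_measure m.+1 (1 : R).
pose theta := push (fun t => t *: axis) nu.
have th0 : kills m.+1 theta := kills_nabla axis nuE.
pose nue e := push (fun z => x i + z) (push (fun z => e *: z) theta).
have nue0 e : bil distk lam (nue e) = 0.
  apply: distk_form_orthogonal => //.
  apply: (@kills_leq _ m.+1); first by rewrite -addnn; lia.
  exact/kills_translate/kills_scale.
(* Only the point [x i] is singular for the difference around it. *)
have lim : e ^- m * bil distk lam (nue e) @[e --> (0 : R)^'+] --> 2 * u i.
  have -> : 2 * u i = \sum_l u l * (if l == i then 2 else 0).
    rewrite (bigD1 i) //= eqxx big1 ?addr0 1?mulrC // => l li.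
    by rewrite (negPf li) mulr0.
  have bE e : e ^- m * bil distk lam (nue e) = \sum_l u l *
      (e ^- m * sint theta (fun z => l2norm ((x l - x i) - e *: z) ^+ m)).
    rewrite /bil lamE mulr_sumr; apply: eq_bigr => l _.
    rewrite mulrCA /nue !sint_push; congr (_ * (_ * _)); apply: eq_sint => z /=.
    by rewrite /distk opprD addrA.
  under eq_cvg do rewrite bE.
  apply: cvg_big => [|l _]; first exact: add_continuous.
  apply: cvgM; first exact: cvg_cst.
  case: (eqVneq l i) => [->|li]; last first.
    have yl0 : x l - x i != 0 by rewrite subr_eq0; apply: contra li => /eqP/xinj->.
    apply: (cvg_eql (jet_cvg (n := n) yl0 (kills_leq (leqnSn m) th0))).
    by rewrite jet_sint_eq0 ?mulr0 // => s sm; apply: th0; rewrite sm.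
  apply: (@cvg_trans _ ((2 : R) @[e --> (0 : R)^'+])); last exact: cvg_cst.
  apply: near_eq_cvg; near=> e.
  have e0 : 0 < e by near: e; exact: nbhs_right_gt.
  rewrite (eq_sint _ (h := fun z => e ^+ m * l2norm z ^+ m)); last first.
    by move=> z; rewrite subrr sub0r -scaleNr l2normZ normrN gtr0_norm // exprMn.
  rewrite sintZ mulKf ?expf_neq0 ?gt_eqF // /theta sint_push nuE.
  rewrite -[LHS](@nablan_abs_exp R m.+1 m 0) ?addn0 //=; last by rewrite odd_double.
  by apply: (@eq_nablan R m.+1) => t /=; rewrite l2normZ l2norm_axis !mulr1.
have : 2 * u i = 0.
  rewrite -(cvg_lim (@Rhausdorff R) lim); apply: (cvg_lim (@Rhausdorff R)).
  by under eq_cvg do rewrite nue0 mulr0; exact: cvg_cst.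
by move/eqP; rewrite mulf_eq0 pnatr_eq0 => /eqP.
Unshelve. all: by end_near. Qed.


(** The form of the part of the even kernel whose monomials both have degree
    at most [n], at scale 1. *)
Definition low_form (T : seq (R * (seq 'I_d * seq 'I_d))) lam : R :=
  \sum_(p <- T | (size p.2.1 <= n)%N && (size p.2.2 <= n)%N)
    p.1 * (sint lam (mon p.2.1) * sint lam (mon p.2.2)).

(** Otherwise let [k] be the largest degree at most [n] of a nonzero moment,
    and split [lam] into homogeneous components, weighted so that the even
    part contributes [low_form T lam] at every scale. As this vanishes, the
    form of the odd power of the distance is nonnegative at the component of
    degree [k], even after adding a multiple of a measure [nu] that kills all
    polynomials involved. When the component shrinks to 0, its own form
    tends to 0 but its product with [nu] does not: for a difference [nu] along
    a line through 0, it tends to a difference of [|t| ^ (2n + 1 - 2k) t ^ k]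
    times the value of a jet. This contradicts Cauchy-Schwarz. *)
Lemma low_form_definite T lam :
  (forall p, p \in T -> (size p.2.1 + size p.2.2 <= n.*2)%N) ->
  (forall e x y, evenk e x y = \sum_(p <- T)
     p.1 * e ^+ (size p.2.1 + size p.2.2) * (mon p.2.1 x * mon p.2.2 y)) ->
  low_form T lam = 0 -> forall s, (size s <= n)%N -> sint lam (mon s) = 0.
Proof.
move=> T_deg T_even low0 s1 s1n; apply/eqP/negPn/negP => s1nz.
pose P k := `[< exists s, [/\ size s = k, (k <= n)%N & sint lam (mon s) != 0] >].
have exP : exists k, P k by exists (size s1); apply/asboolP; exists s1.
have ubP k : P k -> (k <= n)%N by move/asboolP => [s [_ + _]].
case: (ex_maxnP exP ubP) => k /asboolP[s0 [s0k kn s0nz]] kmax.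
have lam0 s : (k < size s <= n)%N -> sint lam (mon s) = 0.
  move=> /andP[ks sn]; apply/eqP/negPn/negP => snz.
  have /kmax : P (size s) by apply/asboolP; exists s.
  by rewrite leqNgt ks.
have [comp compE] := choice (fun j => moment_component n.*2 j lam).
have ck s : (size s <= n.*2)%N ->
    sint (comp k) (mon s) = (size s == k)%:R * sint lam (mon s) by exact: compE.
have k2n : (k <= n.*2)%N by rewrite -addnn; apply: leq_trans kn (leq_addr _ _).
have s0c : sint (comp k) (mon s0) != 0 by rewrite ck s0k // eqxx mul1r.
pose J y := sint (comp k) (jet n k y).
(* The jet is not identically 0 since its form is definite. *)
have [y0 y00 Jy0] : exists2 y, y != 0 & J y != 0.
  have [y Jy] : exists y, J y != 0.
    apply: contrapT => noy.
    have := bil_jet_gt0 (n := n) _ s0c; rewrite s0k => /(_ (leqW kn)).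
    rewrite /bil (eq_sint _ (h := fun=> 0)) ?sint0 ?mulr0 ?ltxx // => y.
    by apply/eqP/negPn/negP => Jy; apply: noy; exists y.
  have [y0|yn0] := eqVneq y 0; last by exists y.
  (* For [k > 0] the jet vanishes at 0, and for [k = 0] it is constant. *)
  exists axis; first exact: axis_neq0.
  apply: contra Jy => /eqP Ja; rewrite y0 -(scale0r axis) /J.
  by rewrite (eq_sint _ (jetZ n k 0 axis)) sintZ -/(J _) Ja mulr0.
have [nu1 nu1E] := nabla_measure m.+1 (1 : R).
pose nu := push (fun t => t *: y0) nu1.
have nu0 : kills m.+1 nu := kills_nabla y0 nu1E.
pose A g := wscale (g ^- k) (push (fun z => g *: z) (comp k)).
(* [A g] is the component of degree [k] shrunk by [g] and rescaled, so that
   its moments of degree at most [2n] do not depend on [g]. *)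
have pos g s : 0 < g -> 0 <= a m * (bil distk (A g) (A g)
    + 2 * (s * bil distk (A g) nu) + s ^+ 2 * bil distk nu nu).
  move=> g0; pose theta j := wscale (g ^- j) (push (fun z => g *: z) (comp j))
      ++ wscale (if j == k then s else 0) nu.
  have thE j t : (size t <= n.*2)%N ->
      sint (theta j) (mon t) = (size t == j)%:R * sint lam (mon t).
    move=> tn; rewrite sint_cat !sint_wscale sint_push nu0 ?mulr0 ?addr0; last first.
      by rewrite ltnS; apply: leqW.
    rewrite (eq_sint _ (h := fun z => g ^+ size t * mon t z)); last first.
      by move=> z /=; rewrite mon_scale.
    rewrite sintZ compE //; case: eqP => [->|_] /=; last by rewrite !mul0r !mulr0.
    by rewrite mul1r mulKf // expf_neq0 // gt_eqF.
  have -> : bil distk (A g) (A g) + 2 * (s * bil distk (A g) nu)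
      + s ^+ 2 * bil distk nu nu = bil distk (theta k) (theta k).
    rewrite /theta eqxx bil_cat; last exact: distkC.
    by rewrite -/(A g) (bil_wscaler _ _ nu) (bil_wscale _ nu) -expr2.
  apply: (leading_form_ge0 (theta := theta)) => e e0.
  set comb := flatten _; have combE t : (size t <= n.*2)%N -> sint comb (mon t)
      = e ^- size t * (size t <= k)%:R * sint lam (mon t).
    move=> tn; rewrite sint_flatten -[k.+1]subn0 -/(index_iota 0 k.+1) big_mkord.
    transitivity (\sum_(j < k.+1)
        e ^- j * ((size t == j)%:R * sint lam (mon t))).
      by apply: eq_bigr => j _; rewrite sint_wscale thE.
    have [tk|kt] := leqP (size t) k.
      rewrite (bigD1 (Ordinal (tk : (size t < k.+1)%N))) //= eqxx big1 ?addr0.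
        by rewrite mulrA.
      move=> j jt; rewrite eq_sym -[_ == size t]/(j == Ordinal (tk : (size t < k.+1)%N)).
      by rewrite (negPf jt) mul0r mulr0.
    rewrite big1 ?mulr0 ?mul0r // => j _; case: eqP => [tj|_].
      by move: (ltn_ord j); rewrite -tj ltnS leqNgt kt.
    by rewrite mul0r mulr0.
  rewrite (bil_evenk _ _ _ T_even) -[RHS]low0 [RHS]big_mkcond /=.
  apply: eq_big_seq => p /T_deg pT.
  have p1n : (size p.2.1 <= n.*2)%N := leq_trans (leq_addr _ _) pT.
  have p2n : (size p.2.2 <= n.*2)%N := leq_trans (leq_addl _ _) pT.
  rewrite !combE //.
  have E t : (size t <= k)%:R * sint lam (mon t)
      = (size t <= n)%:R * sint lam (mon t).
    have [tk|kt] := leqP (size t) k; first by rewrite (leq_trans tk kn).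
    have [tn|nt] := leqP (size t) n; last by [].
    by rewrite lam0 ?kt // !mulr0.
  rewrite -(mulrA (e ^- size p.2.1)) -(mulrA (e ^- size p.2.2)) !E.
  have en0 i : e ^+ i != 0 by rewrite expf_neq0 // gt_eqF.
  rewrite exprD; move: (en0 (size p.2.1)) (en0 (size p.2.2)).
  move: (e ^+ _) (e ^+ _) => u v u0 v0.
  by case: (size p.2.1 <= n)%N; case: (size p.2.2 <= n)%N => /=; field; rewrite ?u0 ?v0.
have AAcvg : bil distk (A g) (A g) @[g --> (0 : R)^'+] --> (0 : R).
  pose B := bil distk (comp k) (comp k).
  apply: (@cvg_trans _ (g ^- k.*2 * g ^+ m * B @[g --> (0 : R)^'+])).
    apply: near_eq_cvg; near=> g.
    have g0 : 0 < g by near: g; exact: nbhs_right_gt.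
    rewrite /A bil_wscale bil_push.
    rewrite (eq_bil _ _ (L := fun x y => g ^+ m * distk x y)); last first.
      by move=> x y; rewrite /distk -scalerBr l2normZ gtr0_norm // exprMn.
    by rewrite bilZ -/B mulrA -addnn exprD invfM.
  apply: (@cvg_eql _ _ _ _ ((m == k.*2)%:R * B)).
    apply: cvgM; last exact: cvg_cst.
    by apply: cvg_right_expB; apply: leqW; rewrite leq_double.
  by rewrite [m == _](_ : _ = false) ?mul0r //; apply/negP => /eqP; lia.
pose lim y := l2norm y ^+ m * dot y y ^- k * J y.
have ABcvg : bil distk (A g) nu @[g --> (0 : R)^'+] --> sint nu lim.
  have E g : bil distk (A g) nu = sint nu (fun y =>
      g ^- k * sint (comp k) (fun z => l2norm (y - g *: z) ^+ m)).
    rewrite /bil exchange_sint; apply: eq_sint => y.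
    rewrite sint_wscale sint_push; congr (_ * _); apply: eq_sint => z /=.
    by rewrite distkC.
  under eq_cvg do rewrite E.
  apply: cvg_sint => y; have [->|yn0] := eqVneq y 0; last first.
    apply: jet_cvg => // s sk; rewrite ck; last exact: leq_trans (ltnW sk) _.
    by rewrite (ltn_eqF sk) mul0r.
  pose C := sint (comp k) (fun z => l2norm z ^+ m).
  apply: (@cvg_trans _ (g ^- k * g ^+ m * C @[g --> (0 : R)^'+])).
    apply: near_eq_cvg; near=> g.
    have g0 : 0 < g by near: g; exact: nbhs_right_gt.
    rewrite -mulrA -sintZ; congr (_ * _); apply: eq_sint => z.
    by rewrite sub0r -scaleNr l2normZ normrN gtr0_norm // exprMn.
  have km : (k < m)%N by rewrite ltnS.
  apply: (@cvg_eql _ _ _ _ ((m == k)%:R * C)).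
    by apply: cvgM; [apply: cvg_right_expB; exact: ltnW | exact: cvg_cst].
  rewrite (gtn_eqF km) mul0r /lim.
  have -> : l2norm (0 : 'rV[R]_d) = 0 by apply/eqP; rewrite l2norm_eq0.
  by rewrite exprS !mul0r.
have limE : sint nu lim = 2 * lim y0.
  have odd_mk : odd (m - k.*2) by rewrite subSn ?leq_double //= -doubleB odd_double.
  rewrite sint_push nu1E -(@nablan_abs_exp R m.+1 (m - k.*2) k) //; last first.
    have : (k.*2 <= m)%N by apply: leqW; rewrite leq_double.
    lia.
  rewrite [RHS]mulrC -nablanZ; apply: (@eq_nablan R m.+1) => t /=.
  have [->|t0] := eqVneq t 0.
    rewrite /lim scale0r normr0 (_ : l2norm 0 = 0) ?expr0n; last first.
      by apply/eqP; rewrite l2norm_eq0.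
    have -> : (m - k.*2)%N == 0%N = false by apply: contraTF odd_mk => /eqP->.
    by rewrite /= !mul0r mulr0.
  have -> : lim (t *: y0) = `|t| ^+ m * ((t ^+ 2) ^- k) * t ^+ k * lim y0.
    rewrite /lim /J (eq_sint _ (jetZ n k t y0)) sintZ -/(J y0).
    have -> : (t ^+ 2) ^+ k = t ^+ k * t ^+ k by rewrite -exprM mulnC exprM expr2.
    rewrite l2normZ dotZl dotZr !exprMn !invfM; ring.
  rewrite mulrC; congr (_ * _); congr (_ * _).
  rewrite -(real_normK (num_real t)) -exprM mul2n; apply: (canLR (mulfK _)).
    by rewrite expf_neq0 ?normr_eq0.
  by rewrite -exprD subnK //; apply: leqW; rewrite leq_double.
have : a m * (2 * lim y0) = 0.
  rewrite -limE; apply: (@lin_quad_ge0 _ _ (a m * bil distk nu nu)) => s.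
  apply: (right_limit_ge0 (fun g => pos g s)).
  apply: (@cvg_eql _ _ _ _ (a m * (0 + 2 * (s * sint nu lim)
                                  + s ^+ 2 * bil distk nu nu))); last by ring.
  apply: cvgM; first exact: cvg_cst.
  apply: cvgD; last exact: cvg_cst.
  apply: cvgD => //; apply: cvgM; first exact: cvg_cst.
  by apply: cvgM; first exact: cvg_cst.
apply/eqP; rewrite !mulf_neq0 ?pnatr_eq0 ?invr_neq0 ?expf_neq0 //.
  by rewrite l2norm_eq0.
by rewrite dot_eq0.
Unshelve. all: by end_near. Qed.

End KernelLimit.

(** * Bordered determinants *)

Section LinearAlgebra.
Variable R : realType.

(** The determinant along the segment is a polynomial without root, to which
    the intermediate value theorem applies. *)
Lemma pencil_det_sign k (A B : 'M[R]_k) :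
  (forall s, 0 <= s <= 1 -> \det ((1 - s) *: A + s *: B) != 0) ->
  0 < \det A * \det B.
Proof.
move=> nz; pose P := map_mx polyC A + 'X *: map_mx polyC (B - A).
have PE s : (\det P).[s] = \det ((1 - s) *: A + s *: B).
  rewrite -[LHS]/(horner_eval s (\det P)) -det_map_mx; congr (\det _).
  apply/matrixP => i j; rewrite !mxE /= /horner_eval !hornerE; ring.
have nz0 : \det A != 0.
  have := nz 0; rewrite subr0 scale1r scale0r addr0.
  by apply; rewrite lexx ler01.
have nz1 : \det B != 0.
  have := nz 1; rewrite subrr scale1r scale0r add0r.
  by apply; rewrite lexx ler01.
have P0 : (\det P).[0] = \det A by rewrite PE subr0 scale1r scale0r addr0.
have P1 : (\det P).[1] = \det B by rewrite PE subrr scale1r scale0r add0r.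
have noroot s : 0 <= s <= 1 -> (\det P).[s] != 0 by rewrite PE; exact: nz.
rewrite lt_def mulf_neq0 //= leNgt; apply/negP => lt0.
have [[a0 b0]|[a0 b0]] : (\det A <= 0 /\ 0 <= \det B) \/ (0 <= \det A /\ \det B <= 0).
  move: lt0; case: (ltrgt0P (\det A)) nz0 => // A0 _ lt0.
  - by right; split => //; move: lt0; rewrite pmulr_rlt0 // => /ltW.
  - by left; split => //; move: lt0; rewrite nmulr_rlt0 // => /ltW.
- have [|s s01 /eqP ps] := @poly_ivt R (\det P) 0 1 ler01.
    by rewrite P0 P1 a0.
  by have := noroot s s01; rewrite ps eqxx.
- have [|s s01 /eqP] := @poly_ivt R (- \det P) 0 1 ler01.
    by rewrite !hornerN P0 P1 oppr_le0 oppr_ge0 a0.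
  by rewrite hornerN => /eqP; rewrite oppr_eq0; apply/negP/noroot.
Qed.

Lemma quad1 k (u : 'cV[R]_k) : (u^T *m u) 0 0 = \sum_i u i 0 ^+ 2.
Proof. by rewrite mxE; apply: eq_bigr => i _; rewrite mxE expr2. Qed.

Lemma quad1_gt0 k (u : 'cV[R]_k) : u != 0 -> 0 < (u^T *m u) 0 0.
Proof.
move=> u0; rewrite quad1 lt_def sumr_ge0 ?andbT => [|i _]; last exact: sqr_ge0.
apply: contra u0 => /eqP u0; apply/eqP/colP => i; rewrite mxE; apply/eqP.
by rewrite -sqrf_eq0 (psumr_eq0P _ u0) // => j _; exact: sqr_ge0.
Qed.

Lemma quad_pencil_gt0 k (L : 'M[R]_k) (u : 'cV[R]_k) s : 0 <= s <= 1 -> u != 0 ->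
  0 < (u^T *m L *m u) 0 0 -> 0 < (u^T *m ((1 - s) *: 1%:M + s *: L) *m u) 0 0.
Proof.
move=> /andP[s0 s1] u0 Lu; have u1 := quad1_gt0 u0.
have -> : (u^T *m ((1 - s) *: 1%:M + s *: L) *m u) 0 0
    = (1 - s) * (u^T *m u) 0 0 + s * (u^T *m L *m u) 0 0.
  by rewrite mulmxDr mulmxDl -!scalemxAr mulmx1 -!scalemxAl mxE !mxE.
have [s10|s10] := eqVneq s 0; first by rewrite s10 subr0 mul1r mul0r addr0.
apply: ltr_wpDl; first by apply: mulr_ge0; [rewrite subr_ge0 | exact: ltW].
by apply: mulr_gt0 => //; rewrite lt_def s10.
Qed.

Lemma posdefmx_det_gt0 k (A : 'M[R]_k) : posdefmx A -> 0 < \det A.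
Proof.
move=> [_ pos]; rewrite -[\det A]mul1r -(det1 R k); apply: pencil_det_sign => s s01.
apply/negP => /det0P[v v0 vA].
have vT0 : v^T != 0 by apply: contra v0; rewrite trmx_eq0.
have := quad_pencil_gt0 s01 vT0 (pos _ vT0).
by rewrite trmxK vA mul0mx mxE ltxx.
Qed.

(** A segment of nonsingular bordered matrices, all with a form positive on
    the kernel of [V^T], joins the matrix to the one where [L] is the identity,
    whose determinant is that of [- V^T V]. *)
Lemma bordered_det_gt0 k p (L : 'M[R]_k) (V : 'M[R]_(k, p)) :
  \rank V = p ->
  (forall u : 'cV[R]_k, V^T *m u = 0 -> u != 0 -> 0 < (u^T *m L *m u) 0 0) ->
  0 < (-1) ^+ p * \det (block_mx L V V^T 0).
Proof.
move=> rV pos.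
have Vfree : row_free V^T by rewrite /row_free mxrank_tr rV.
have VV : 0 < \det (V^T *m V).
  apply: posdefmx_det_gt0; split; first by rewrite trmx_mul trmxK.
  move=> u u0.
  have -> : u^T *m (V^T *m V) *m u = (V *m u)^T *m (V *m u).
    by rewrite trmx_mul !mulmxA.
  apply: quad1_gt0.
  apply: contra u0 => /eqP Vu; rewrite -trmx_eq0 -(inj_eq (row_free_inj Vfree)).
  by rewrite mul0mx -trmx_mul Vu trmx0.
have E1 : \det (block_mx 1%:M V V^T 0) = (-1) ^+ p * \det (V^T *m V).
  have : \det (block_mx 1%:M V V^T 0) * \det (block_mx 1%:M (- V) 0 (1%:M : 'M[R]_p))
       = \det (block_mx (1%:M : 'M[R]_k) 0 V^T (- (V^T *m V))).
    rewrite -det_mulmx mulmx_block !mulmx1 !mulmx0 !addr0 !mul1mx addNr.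
    by rewrite mulmxN.
  by rewrite det_ublock det_lblock !det1 !mul1r mulr1 -scaleN1r detZ.
rewrite -(pmulr_lgt0 _ VV) -mulrA [_ * \det (V^T *m V)]mulrC mulrA -E1.
apply: pencil_det_sign => s s01; apply/negP => /det0P[w w0].
rewrite !scale_block_mx add_block_mx -!scalerDl subrK !scale1r.
rewrite -[w]hsubmxK; set u := lsubmx w; set b := rsubmx w.
rewrite mul_row_block mulmx0 addr0 -row_mx0 => /eq_row_mx[uL uV].
have u0 : u = 0.
  apply/eqP/negPn/negP => u0; have uT0 : u^T != 0 by rewrite trmx_eq0.
  have VuT : V^T *m u^T = 0 by rewrite -trmx_mul uV trmx0.
  have := quad_pencil_gt0 s01 uT0 (pos _ VuT uT0).
  move/eqP: uL; rewrite addr_eq0 => /eqP uL.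
  by rewrite trmxK uL mulNmx -mulmxA VuT mulmx0 oppr0 mxE ltxx.
move: uL; rewrite u0 mul0mx add0r => /eqP; rewrite -[0](mul0mx _ V^T).
rewrite (inj_eq (row_free_inj Vfree)) => /eqP b0.
by move: w0; rewrite -[w]hsubmxK -/u -/b u0 b0 row_mx0 eqxx.
Qed.

Lemma bordered_det_eq0 k p (L : 'M[R]_k) (V : 'M[R]_(k, p)) :
  \rank V != p -> \det (block_mx L V V^T 0) = 0.
Proof.
move=> rV; apply/eqP/det0P.
have : kermx V^T != 0 by rewrite kermx_eq0 /row_free mxrank_tr.
case/rowV0Pn => b /sub_kermxP bV b0; exists (row_mx 0 b).
  by apply: contra b0 => /eqP; rewrite -row_mx0 => /eq_row_mx[_ ->].
by rewrite mul_row_block !mul0mx mulmx0 bV !add0r row_mx0.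
Qed.

Lemma bordered_detZ k p c (L : 'M[R]_k) (V : 'M[R]_(k, p)) : c != 0 ->
  \det (block_mx (c *: L) V V^T 0) * c ^+ p = c ^+ k * \det (block_mx L V V^T 0).
Proof.
move=> c0.
have : block_mx (c *: L) V V^T 0 *m block_mx 1%:M 0 0 (c%:M : 'M[R]_p)
     = block_mx (c%:M : 'M[R]_k) 0 0 1%:M *m block_mx L V V^T 0.
  rewrite !mulmx_block !mulmx1 !mulmx0 !mul0mx !mul1mx !addr0 !add0r.
  by rewrite !mul_scalar_mx mul_mx_scalar.
by move/(congr1 determinant); rewrite !det_mulmx !det_ublock !det1 !det_scalar mul1r mulr1.
Qed.

(** Schur complement, scaled so that both diagonal blocks have limits. *)
Lemma det_schur k p (t : R) (E : 'M[R]_k) (V : 'M[R]_(k, p)) (V' : 'M[R]_(p, k))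
    (M M' : 'M[R]_p) : t != 0 -> M *m M' = 1%:M ->
  \det (E + V *m M *m V') = t ^+ k / t ^+ p * \det M
     * ((-1) ^+ p * \det (block_mx (t^-1 *: E) V V' (- t *: M'))).
Proof.
move=> t0 MM'; have M'M := mulmx1C MM'.
have detM : \det M * \det M' = 1 by rewrite -det_mulmx MM' det1.
have M0 : \det M' != 0.
  by apply/eqP => M0; move: detM; rewrite M0 mulr0 => /eqP; rewrite eq_sym oner_eq0.
have : \det (block_mx (t^-1 *: E) V V' (- t *: M'))
     * \det (block_mx (1%:M : 'M[R]_k) 0 (t^-1 *: (M *m V')) (1%:M : 'M[R]_p))
     = \det (block_mx (t^-1 *: (E + V *m M *m V')) V 0 (- t *: M')).
  rewrite -det_mulmx mulmx_block !mulmx1 !mulmx0 !add0r; congr (\det (block_mx _ _ _ _)).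
    by rewrite -scalemxAr scalerDr mulmxA.
  rewrite -scalemxAr -scalemxAl scalerA mulrN mulVf // scaleN1r mulmxA M'M mul1mx.
  by rewrite subrr.
rewrite det_lblock det_ublock !det1 !mulr1 !detZ => ->.
rewrite [(- t) ^+ p]exprNn exprVn; set q := \det (E + _).
have tk : t ^+ k != 0 by rewrite expf_neq0.
have tp : t ^+ p != 0 by rewrite expf_neq0.
have -> : \det M = (\det M')^-1 by rewrite -[LHS](mulfK M0) detM mul1r.
have s2 : (-1) ^+ p * (-1) ^+ p = 1 :> R by rewrite -expr2 sqrr_sign.
transitivity (((-1) ^+ p * (-1) ^+ p) * q); first by rewrite s2 mul1r.
by move: tk tp; move: (t ^+ k) (t ^+ p) ((-1) ^+ p) => u v w u0 v0; field; rewrite u0 v0 M0.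
Qed.

Lemma cvg_det T (F : set_system T) {FF : Filter F} k (A : T -> 'M[R]_k)
    (B : 'M[R]_k) :
  (forall i j, A e i j @[e --> F] --> B i j) -> \det (A e) @[e --> F] --> \det B.
Proof.
move=> AB; apply: cvg_big => [|s _]; first exact: add_continuous.
apply: cvgM; first exact: cvg_cst.
by apply: cvg_big => [|i _ //]; exact: mul_continuous.
Qed.

End LinearAlgebra.

(** * The flat limit of the determinants *)

Section FlatLimit.
Variables (R : realType) (d n : nat) (f : R -> R) (a : nat -> R).
Local Notation m := n.*2.+1.
Hypothesis odd0 : forall i, odd i -> (i < m)%N -> a i = 0.
Hypothesis fseries : power_series_at0 f a.
Variable T : seq (R * (seq 'I_d * seq 'I_d)).
Hypothesis T_deg : forall p, p \in T -> (size p.2.1 + size p.2.2 <= n.*2)%N.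
Hypothesis T_even : forall e x y, evenk n a e x y = \sum_(p <- T)
  p.1 * e ^+ (size p.2.1 + size p.2.2) * (mon p.2.1 x * mon p.2.2 y).
Variables (p : nat) (V : 'rV[R]_d -> 'I_p -> R) (dg : 'I_p -> nat).
Variable idx : seq 'I_d -> 'I_p.
Hypothesis dg_le : forall j, (dg j <= n)%N.
Hypothesis dg_idx : forall s, (size s <= n)%N -> dg (idx s) = size s.
Hypothesis V_idx : forall s x, (size s <= n)%N -> V x (idx s) = mon s x.

Let low (q : R * (seq 'I_d * seq 'I_d)) :=
  (size q.2.1 <= n)%N && (size q.2.2 <= n)%N.

(** The Wronskian matrix of the even part: its coefficients on the pairs of
    monomials of degree at most [n]. *)
Definition wronskian : 'M[R]_p :=
  \matrix_(i, j) \sum_(q <- T | low q && (idx q.2.1 == i) && (idx q.2.2 == j)) q.1.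

Definition degree_scale (e : R) : 'M[R]_p := diag_mx (\row_j e ^+ dg j).

Lemma sum_wronskian (u v : 'I_p -> R) :
  \sum_i \sum_j u i * wronskian i j * v j
  = \sum_(q <- T | low q) q.1 * (u (idx q.2.1) * v (idx q.2.2)).
Proof.
transitivity (\sum_i \sum_j \sum_(q <- T | low q)
    (if (idx q.2.1 == i) && (idx q.2.2 == j) then q.1 * (u i * v j) else 0)).
  apply: eq_bigr => i _; apply: eq_bigr => j _; rewrite mxE mulr_sumr mulr_suml.
  rewrite -big_mkcondr; apply: eq_big => [q|q _]; first by rewrite andbA.
  ring.
under eq_bigr do rewrite exchange_big; rewrite exchange_big /=.
apply: eq_bigr => q _; rewrite (bigD1 (idx q.2.1)) //= eqxx [X in _ + X]big1 ?addr0.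
  rewrite (bigD1 (idx q.2.2)) //= eqxx [X in _ + X]big1 ?addr0 // => j jq.
  by rewrite eq_sym (negPf jq).
by move=> i iq; apply: big1 => j _; rewrite [idx q.2.1 == i]eq_sym (negPf iq).
Qed.

Hypothesis W_unit : wronskian \in unitmx.

Section Points.
Variables (k : nat) (y : 'I_k -> 'rV[R]_d).

Let VX : 'M[R]_(k, p) := \matrix_(i, j) V (y i) j.
(* The terms whose left monomial, for [H], or right monomial, for [H'], has
   degree more than [n]; the other monomial then has degree less than [n]. *)
Let H e : 'M[R]_(k, p) := \matrix_(i, j)
  \sum_(q <- T | (n < size q.2.1)%N && (idx q.2.2 == j))
    q.1 * e ^+ size q.2.1 * mon q.2.1 (y i).
Let H' e : 'M[R]_(p, k) := \matrix_(j, i)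
  \sum_(q <- T | (n < size q.2.2)%N && (idx q.2.1 == j))
    q.1 * e ^+ size q.2.2 * mon q.2.2 (y i).

Lemma even_decomposition e : \matrix_(i, j) evenk n a e (y i) (y j)
  = VX *m (degree_scale e *m wronskian *m degree_scale e) *m VX^T
    + H e *m degree_scale e *m VX^T + VX *m degree_scale e *m H' e.
Proof.
apply/matrixP => i j; rewrite [LHS]mxE T_even.
have sumE (u : 'I_p -> R) (P : pred (R * (seq 'I_d * seq 'I_d))) F g :
    \sum_l (\sum_(q <- T | P q && (g q == l)) F q) * u l
    = \sum_(q <- T | P q) F q * u (g q).
  under eq_bigr => l _ do rewrite mulr_suml.
  rewrite (exchange_big_dep P) /=; last by move=> l q _ /andP[].
  apply: eq_bigr => q Pq; rewrite (bigD1 (g q)) /= ?Pq ?eqxx //.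
  by rewrite big1 ?addr0 // => l /andP[/andP[_ /eqP->]]; rewrite eqxx.
have E1 : (VX *m (degree_scale e *m wronskian *m degree_scale e) *m VX^T) i j
    = \sum_(q <- T | low q) q.1 * ((V (y i) (idx q.2.1) * e ^+ dg (idx q.2.1))
                                * (e ^+ dg (idx q.2.2) * V (y j) (idx q.2.2))).
  rewrite -(sum_wronskian (fun l => V (y i) l * e ^+ dg l)
                          (fun l => e ^+ dg l * V (y j) l)).
  rewrite exchange_big /= !mulmxA mxE; apply: eq_bigr => l _.
  rewrite mul_mx_diag [in LHS]mxE [VX^T _ _]mxE [VX _ _]mxE [in LHS]mxE.
  rewrite [(\row_j _) _ _]mxE -mulrA mulr_suml; apply: eq_bigr => l' _.
  by rewrite mul_mx_diag [in LHS]mxE [VX _ _]mxE [(\row_j _) _ _]mxE.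
have E2 : (H e *m degree_scale e *m VX^T) i j
    = \sum_(q <- T | (n < size q.2.1)%N)
       q.1 * e ^+ size q.2.1 * mon q.2.1 (y i)
        * (e ^+ dg (idx q.2.2) * V (y j) (idx q.2.2)).
  rewrite -(sumE (fun l => e ^+ dg l * V (y j) l)) mxE; apply: eq_bigr => l _.
  by rewrite mul_mx_diag [in LHS]mxE !mxE mulrA.
have E3 : (VX *m degree_scale e *m H' e) i j
    = \sum_(q <- T | (n < size q.2.2)%N)
       q.1 * e ^+ size q.2.2 * mon q.2.2 (y j)
        * (e ^+ dg (idx q.2.1) * V (y i) (idx q.2.1)).
  rewrite -(sumE (fun l => e ^+ dg l * V (y i) l)) mxE; apply: eq_bigr => l _.
  by rewrite mul_mx_diag [in LHS]mxE !mxE [RHS]mulrC [V _ _ * _]mulrC.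
rewrite [RHS]mxE [X in X + _]mxE.
rewrite [RHS]big_mkcond in E1; rewrite [RHS]big_mkcond in E2.
rewrite [RHS]big_mkcond in E3; rewrite E1 E2 E3 -!big_split /=; apply: eq_big_seq => q qT.
have qn := T_deg qT; rewrite /low.
have [s1|s1] := leqP (size q.2.1) n; have [s2|s2] := leqP (size q.2.2) n => /=.
- by rewrite !dg_idx // !V_idx // exprD; ring.
- by rewrite dg_idx // V_idx // exprD; ring.
- by rewrite dg_idx // V_idx // exprD; ring.
- by have := leq_trans (leq_add s1 s2) qn; rewrite -addnn; lia.
Qed.

Let Wi := invmx wronskian.
Let Di (e : R) : 'M[R]_p := diag_mx (\row_j e ^- dg j).

Lemma degree_scaleV e : 0 < e ->
  degree_scale e *m Di e = 1%:M /\ Di e *m degree_scale e = 1%:M.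
Proof.
move=> e0; split; apply/matrixP => i j; rewrite mul_diag_mx !mxE;
  case: eqP => [->|_]; rewrite ?mulr0n ?mulr0 // !mulr1n ?mulfV ?mulVf //;
  by rewrite expf_neq0 // gt_eqF.
Qed.

Lemma cvg_high (P : pred (R * (seq 'I_d * seq 'I_d)))
    (g : R * (seq 'I_d * seq 'I_d) -> seq 'I_d) x l :
  (forall q, P q -> (n < size (g q))%N) -> (l <= n.+1)%N ->
  e ^- l * (\sum_(q <- T | P q) q.1 * e ^+ size (g q) * mon (g q) x)
    @[e --> (0 : R)^'+]
    --> \sum_(q <- T | P q) q.1 * (size (g q) == l)%:R * mon (g q) x.
Proof.
move=> gP ln; under eq_cvg do rewrite mulr_sumr.
apply: cvg_big => [|q Pq]; first exact: add_continuous.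
under eq_cvg => e do rewrite mulrA mulrCA.
apply: cvgM; last exact: cvg_cst; apply: cvgM; first exact: cvg_cst.
by apply: cvg_right_expB; apply: leq_trans ln (gP _ Pq).
Qed.

Lemma cvg_high0 (P : pred (R * (seq 'I_d * seq 'I_d)))
    (g : R * (seq 'I_d * seq 'I_d) -> seq 'I_d) x l :
  (forall q, P q -> (n < size (g q))%N) -> (l <= n)%N ->
  e ^- l * (\sum_(q <- T | P q) q.1 * e ^+ size (g q) * mon (g q) x)
    @[e --> (0 : R)^'+] --> (0 : R).
Proof.
move=> gP ln; apply: (cvg_eql (cvg_high gP (leqW ln))).
apply: big1 => q /gP nq; rewrite gtn_eqF ?mulr0 ?mul0r //.
exact: leq_ltn_trans nq.
Qed.

(** The terms with one monomial of degree above [n] are too large to neglect;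
    completing the square absorbs them into the bordering blocks, where they
    tend to 0. *)
Lemma det_flat_limit : exists h : R -> R,
  (forall e, 0 < e ->
     \det (\matrix_(i, j) scaled_kernel f e (y i) (y j))
     = (e ^+ m) ^+ k / (e ^+ m) ^+ p
       * \det (degree_scale e *m wronskian *m degree_scale e) * h e) /\
  h e @[e --> (0 : R)^'+] --> (-1) ^+ p *
    \det (block_mx (a m *: \matrix_(i, j) distk n (y i) (y j)) VX VX^T 0).
Proof.
pose S e : 'M[R]_k :=
  \matrix_(i, j) (scaled_kernel f e (y i) (y j) - evenk n a e (y i) (y j)).
pose E e := S e - H e *m Wi *m H' e.
pose VL e := VX + H e *m Wi *m Di e.
pose VR e := VX^T + Di e *m Wi *m H' e.
pose Mi e := Di e *m Wi *m Di e.
pose B e := block_mx ((e ^+ m)^-1 *: E e) (VL e) (VR e) (- (e ^+ m) *: Mi e).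
exists (fun e => (-1) ^+ p * \det (B e)); split=> [e e0|].
  have [DDi DiD] := degree_scaleV e0.
  have WWi : wronskian *m Wi = 1%:M by rewrite mulmxV.
  have WiW : Wi *m wronskian = 1%:M by rewrite mulVmx.
  set D := degree_scale e in DDi DiD *; set W := wronskian in WWi WiW *.
  have MMi : D *m W *m D *m Mi e = 1%:M.
    rewrite /Mi !mulmxA -[D *m W *m D *m Di e]mulmxA DDi mulmx1.
    by rewrite -[D *m W *m Wi]mulmxA WWi mulmx1.
  rewrite -det_schur //; last by rewrite expf_neq0 // gt_eqF.
  congr (\det _).
  have -> : \matrix_(i, j) scaled_kernel f e (y i) (y j)
      = S e + \matrix_(i, j) evenk n a e (y i) (y j).
    by apply/matrixP => i j; rewrite !mxE subrK.
  have VLM : VL e *m (D *m W *m D) = VX *m (D *m W *m D) + H e *m D.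
    rewrite /VL mulmxDl; congr (_ + _); rewrite !mulmxA.
    by rewrite -(mulmxA _ (Di e)) DiD mulmx1 -(mulmxA _ Wi) WiW mulmx1.
  have V1 : VX *m (D *m W *m D) *m (Di e *m Wi *m H' e) = VX *m D *m H' e.
    rewrite !mulmxA -(mulmxA _ D (Di e)) DDi mulmx1.
    by rewrite -(mulmxA _ W Wi) WWi mulmx1.
  have V2 : H e *m D *m (Di e *m Wi *m H' e) = H e *m Wi *m H' e.
    by rewrite !mulmxA -(mulmxA _ D (Di e)) DDi mulmx1.
  rewrite VLM /VR mulmxDr 2!mulmxDl V1 V2 even_decomposition -/D -/W /E.
  by rewrite [X in _ = _ + X]addrA
    [X in _ = _ + X]addrC [RHS]addrA subrK.
apply: cvgM; first exact: cvg_cst.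
have HWi i j e l : (H e *m Wi) i j * l = \sum_c l * H e i c * Wi c j.
  rewrite mxE mulr_suml; apply: eq_bigr => c _; ring.
apply: cvg_det => i j; case: (split_ordP i) => i' ->; case: (split_ordP j) => j' ->.
- rewrite block_mxEul; under eq_cvg do rewrite block_mxEul.
  apply: (@cvg_eql _ _ _ _ (a m * distk n (y i') (y j') - 0)); last by rewrite subr0 !mxE.
  have EE e : ((e ^+ m)^-1 *: E e) i' j'
     = e ^- m * (scaled_kernel f e (y i') (y j') - evenk n a e (y i') (y j'))
       - \sum_c \sum_b (e ^- n * H e i' b) * Wi b c * (e ^- n.+1 * H' e c j').
    rewrite mxE [X in _ * X]mxE [X in _ * (X + _)]mxE [X in _ * (_ + X)]mxE.
    rewrite mulrBr; congr (_ - _); rewrite mxE mulr_sumr; apply: eq_bigr => c _.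
    rewrite mxE mulr_suml mulr_sumr; apply: eq_bigr => b _.
    have -> : m = (n + n.+1)%N by rewrite -addnn addnS.
    rewrite exprD invfM; ring.
  under eq_cvg do rewrite EE.
  (* [m = n + (n + 1)] shares the division between two factors of order at
     least [n + 1]. *)
  apply: cvgB; first exact: odd_part_cvg.
  apply: (@cvg_eql _ _ _ _ (\sum_(c < p) \sum_(b < p) 0)); last first.
    by rewrite big1 // => c _; rewrite big1.
  apply: cvg_big => [|c _]; first exact: add_continuous.
  apply: cvg_big => [|b _]; first exact: add_continuous.
  rewrite /H /H'; under eq_cvg => e do rewrite [(\matrix_(_, _) _) i' b]mxE
    [(\matrix_(_, _) _) c j']mxE.
  pose lim := \sum_(q <- T | (n < size q.2.2)%N && (idx q.2.1 == c))
    q.1 * (size q.2.2 == n.+1)%:R * mon q.2.2 (y j').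
  apply: (@cvg_eql _ _ _ _ (0 * Wi b c * lim)); last by rewrite !mul0r.
  apply: cvgM; first apply: cvgM.
  + by apply: (cvg_high0 (g := fun q => q.2.1)) => // q /andP[].
  + exact: cvg_cst.
  + by apply: (cvg_high (g := fun q => q.2.2)) => // q /andP[].
- rewrite block_mxEur; under eq_cvg do rewrite block_mxEur.
  apply: (@cvg_eql _ _ _ _ (VX i' j' + 0)); last by rewrite addr0.
  have EE e : VL e i' j' = VX i' j' + \sum_b (e ^- dg j' * H e i' b) * Wi b j'.
    rewrite /VL mxE mul_mx_diag; congr (_ + _).
    by rewrite [LHS]mxE [(\row__ _) _ _]mxE HWi.
  under eq_cvg do rewrite EE.
  apply: cvgD; first exact: cvg_cst.
  apply: (@cvg_eql _ _ _ _ (\sum_(b < p) 0)); last by rewrite big1.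
  apply: cvg_big => [|b _]; first exact: add_continuous.
  apply: (@cvg_eql _ _ _ _ (0 * Wi b j')); last by rewrite mul0r.
  apply: cvgM; last exact: cvg_cst.
  rewrite /H; under eq_cvg => e do rewrite [(\matrix_(_, _) _) i' b]mxE.
  by apply: (cvg_high0 (g := fun q => q.2.1)) => // q /andP[].
- rewrite block_mxEdl; under eq_cvg do rewrite block_mxEdl.
  apply: (@cvg_eql _ _ _ _ (VX^T i' j' + 0)); last by rewrite addr0.
  have EE e : VR e i' j' = VX^T i' j' + \sum_b Wi i' b * (e ^- dg i' * H' e b j').
    rewrite /VR mxE -mulmxA mul_diag_mx; congr (_ + _).
    rewrite [LHS]mxE [(\row__ _) _ _]mxE mxE mulr_sumr.
    by apply: eq_bigr => b _; rewrite mulrCA.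
  under eq_cvg do rewrite EE.
  apply: cvgD; first exact: cvg_cst.
  apply: (@cvg_eql _ _ _ _ (\sum_(b < p) 0)); last by rewrite big1.
  apply: cvg_big => [|b _]; first exact: add_continuous.
  apply: (@cvg_eql _ _ _ _ (Wi i' b * 0)); last by rewrite mulr0.
  apply: cvgM; first exact: cvg_cst.
  rewrite /H'; under eq_cvg => e do rewrite [(\matrix_(_, _) _) b j']mxE.
  by apply: (cvg_high0 (g := fun q => q.2.2)) => // q /andP[].
- apply: (@cvg_eql _ _ _ _
    (- ((n == dg i')%:R * Wi i' j' * (n.+1 == dg j')%:R))); last first.
    by rewrite block_mxEdr [n.+1 == _]gtn_eqF ?ltnS // mulr0 oppr0 mxE.
  have EE e : B e (rshift k i') (rshift k j')
     = - ((e ^- dg i' * e ^+ n) * Wi i' j' * (e ^- dg j' * e ^+ n.+1)).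
    rewrite /B block_mxEdr mxE /Mi mul_mx_diag mxE mul_diag_mx mxE ![(\row__ _) _ _]mxE.
    have -> : m = (n + n.+1)%N by rewrite -addnn addnS.
    rewrite exprD; ring.
  under eq_cvg do rewrite EE.
  apply: cvgN; apply: cvgM; first apply: cvgM.
  + exact: cvg_right_expB.
  + exact: cvg_cst.
  + by apply: cvg_right_expB; apply: leqW.
Qed.

End Points.
End FlatLimit.

(** * Columns of the Vandermonde matrix *)

Section MonomialColumns.
Variables (R : realType) (d k : nat).

Definition mcol (j : 'I_('C(k + d, d))) : d.-tuple 'I_k.+1 :=
  nth [tuple of nseq d ord0] (monomials k d) j.

Definition mval (x : 'rV[R]_d) j : R := \prod_(l < d) x 0 l ^+ tnth (mcol j) l.

Lemma mdegree_tnth (alpha : d.-tuple 'I_k.+1) :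
  mdegree alpha = (\sum_(l < d) tnth alpha l)%N.
Proof. by rewrite /mdegree big_tuple. Qed.

Lemma mcol_degree j : (mdegree (mcol j) <= k)%N.
Proof.
have : mcol j \in monomials k d by rewrite mem_nth // size_monomials.
by rewrite mem_sort mem_enum inE.
Qed.

Lemma mon_count (s : seq 'I_d) (x : 'rV[R]_d) :
  mon s x = \prod_(l < d) x 0 l ^+ count_mem l s.
Proof.
elim: s => [|l s IHs]; first by rewrite mon_nil big1.
rewrite mon_cons IHs (bigD1 l) //= [RHS](bigD1 l) //= eqxx exprD expr1 mulrA.
congr (_ * _); apply: eq_bigr => i il; rewrite eq_sym.
by rewrite (negPf il).
Qed.

Lemma size_count (s : seq 'I_d) : (\sum_(l < d) count_mem l s)%N = size s.
Proof.
elim: s => [|l s IHs]; first by rewrite big1.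
rewrite big_split /= IHs (bigD1 l) //= eqxx big1 // => i il.
by rewrite eq_sym (negPf il).
Qed.

Lemma mcol_of_word (s : seq 'I_d) : (size s <= k)%N ->
  exists j, mdegree (mcol j) = size s /\ forall x, mval x j = mon s x.
Proof.
move=> sk; pose alpha : d.-tuple 'I_k.+1 := [tuple inord (count_mem l s) | l < d].
have alphaE l : tnth alpha l = count_mem l s :> nat.
  by rewrite tnth_mktuple inordK // ltnS (leq_trans (count_size _ _)).
have deg : mdegree alpha = size s.
  by rewrite mdegree_tnth -size_count; apply: eq_bigr => l _.
have alpha_in : alpha \in monomials k d by rewrite mem_sort mem_enum inE deg.
have ltj : (index alpha (monomials k d) < 'C(k + d, d))%N.
  by rewrite -size_monomials index_mem.
have colE : mcol (Ordinal ltj) = alpha by rewrite /mcol /= nth_index.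
exists (Ordinal ltj); split=> [|x]; first by rewrite colE.
by rewrite /mval mon_count colE; apply: eq_bigr => l _; rewrite alphaE.
Qed.

Lemma word_of_mcol j : exists s : seq 'I_d,
  (size s <= k)%N /\ forall x, mval x j = mon s x.
Proof.
pose s := flatten [seq nseq (tnth (mcol j) l) l | l <- enum 'I_d].
exists s; split=> [|x].
  apply: leq_trans (mcol_degree j); rewrite size_flatten /shape -map_comp.
  rewrite sumnE big_map big_enum.
  by rewrite mdegree_tnth; apply/leq_sum => l _ /=; rewrite size_nseq.
rewrite /mon /s big_flatten big_map big_enum; apply: eq_bigr => l _ /=.
elim: (nat_of_ord _) => [|c IHc]; first by rewrite big_nil.
by rewrite big_cons -IHc exprS.
Qed.

End MonomialColumns.

(** * Laws of fixed size *)

Section FixedSizeLaws.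
Variables (R : realType) (n m : nat).
Implicit Types (w P : {set 'I_n} -> R).

Lemma fixed_size_law_exists w : (forall X : {set 'I_n}, #|X| = m -> 0 <= w X) ->
  (exists2 X : {set 'I_n}, #|X| = m & 0 < w X) -> exists P, fixed_size_law m w P.
Proof.
move=> w0 [X0 X0m wX0]; pose s := \sum_(X : {set 'I_n} | #|X| == m) w X.
have s0 : 0 < s.
  rewrite /s (bigD1 X0) ?X0m ?eqxx //=; apply: ltr_wpDr => //.
  by apply: sumr_ge0 => X /andP[/eqP Xm _]; exact: w0.
exists (fun X : {set 'I_n} => if #|X| == m then s^-1 * w X else 0); split.
  split=> [X|]; last by rewrite -big_mkcond -mulr_sumr mulVf // gt_eqF.
  by case: eqP => // Xm; rewrite mulr_ge0 ?w0 // invr_ge0 ltW.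
by exists s^-1; rewrite ?invr_gt0.
Qed.

Lemma fixed_size_lawE w P : fixed_size_law m w P ->
  \sum_(X : {set 'I_n} | #|X| == m) w X != 0 /\
  forall X : {set 'I_n}, P X = if #|X| == m then w X / \sum_(Y : {set 'I_n} | #|Y| == m) w Y else 0.
Proof.
move=> [[_ P1] [c c0 PE]]; set s := \sum_(X | _) _.
have cs : c * s = 1.
  by rewrite -P1 mulr_sumr big_mkcond; apply: eq_bigr => X _; rewrite PE.
have s0 : s != 0.
  by apply: contra_eq_neq cs => ->; rewrite mulr0 eq_sym oner_neq0.
split=> // X; rewrite PE; case: ifP => // _.
by rewrite -[c](mulfK s0) cs mul1r mulrC.
Qed.

(** The limits of the weights need only exist after division by a common
    factor. *)
Lemma fixed_size_law_cvg (g : R -> R) (h we : R -> {set 'I_n} -> R) w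
    (C : R) (Pe : R -> {set 'I_n} -> R) P :
  C != 0 -> (forall e, 0 < e -> g e != 0) ->
  (forall e (X : {set 'I_n}), 0 < e -> #|X| = m -> we e X = g e * h e X) ->
  (forall X : {set 'I_n}, #|X| = m -> h e X @[e --> (0 : R)^'+] --> C * w X) ->
  (forall e, 0 < e -> fixed_size_law m (we e) (Pe e)) ->
  fixed_size_law m w P ->
  forall X, Pe e X @[e --> (0 : R)^'+] --> P X.
Proof.
move=> C0 g0 weE hlim /[swap] /fixed_size_lawE[s0 PE] PeE X.
rewrite PE; case: eqP => [Xm|Xm]; last first.
  apply: (@cvg_trans _ ((0 : R) @[e --> (0 : R)^'+])); last exact: cvg_cst.
  apply: near_eq_cvg; near=> e.
  have e0 : 0 < e by near: e; exact: nbhs_right_gt.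
  by have [_ ->] := fixed_size_lawE (PeE e e0); move/eqP/negPf: Xm => ->.
pose sh e := \sum_(Y : {set 'I_n} | #|Y| == m) h e Y.
apply: (@cvg_trans _ (h e X / sh e @[e --> (0 : R)^'+])).
  apply: near_eq_cvg; near=> e.
  have e0 : 0 < e by near: e; exact: nbhs_right_gt.
  have [_ ->] := fixed_size_lawE (PeE e e0); rewrite Xm eqxx weE //.
  have -> : \sum_(Y : {set 'I_n} | #|Y| == m) we e Y = g e * sh e.
    by rewrite mulr_sumr; apply: eq_bigr => Y /eqP Ym; rewrite weE.
  by rewrite invfM mulrACA mulfV ?mul1r ?g0.
apply: (@cvg_eql _ _ _ _ (C * w X / (C * \sum_(Y : {set 'I_n} | #|Y| == m) w Y))); last first.
  by rewrite invfM mulrACA mulfV ?mul1r.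
apply: cvgM; first exact: hlim.
apply: cvgV; first by rewrite mulf_neq0.
rewrite mulr_sumr; apply: cvg_big => [|Y /eqP Ym]; first exact: add_continuous.
exact: hlim.
Unshelve. all: by end_near. Qed.

Lemma set_extension (A : {set 'I_n}) : (#|A| <= m <= n)%N ->
  exists2 B : {set 'I_n}, A \subset B & #|B| = m.
Proof.
elim: (m) => [|l IHl] /andP[Al ln].
  by exists A => //; apply/eqP; rewrite -leqn0.
case: (ltngtP #|A| l.+1) Al => // [Al _|Al _]; last by exists A.
have [|B AB Bl] := IHl; first by rewrite -ltnS Al ltnW.
have /subsetPn[z _ zB] : ~~ ([set: 'I_n]%SET \subset B).
  by apply/negP => /subset_leq_card; rewrite cardsT card_ord Bl leqNgt ln.
exists (z |: B)%SET; last by rewrite cardsU1 zB Bl.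
by apply: (fintype.subset_trans AB); exact: finset.subsetU1.
Qed.

End FixedSizeLaws.

(** * Convergence of the determinantal laws *)

Section Convergence.
Variables (R : realType) (d n : nat).
Variables (kappa : 'rV[R]_d -> 'rV[R]_d -> R) (f : R -> R) (a : nat -> R).
Local Notation m := n.*2.+1.
Local Notation p := 'C(n + d, d).
Hypothesis d_gt0 : (0 < d)%N.
Hypothesis kappa_pd : posdef_kernel kappa.
Hypothesis kappa_st : stationary kappa f.
Hypothesis fseries : power_series_at0 f a.
Hypothesis odd0 : forall i, odd i -> (i < m)%N -> a i = 0.
Hypothesis am_neq0 : a m != 0.

Lemma scaled_kernelE e u v : 0 < e ->
  scaled_kernel f e u v = kappa (e *: u) (e *: v).
Proof.
by move=> e0; rewrite kappa_st -scalerBr l2normZ gtr0_norm.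
Qed.

Lemma scaled_kernel_bil_ge0 e (mu : seq (R * 'rV[R]_d)) : 0 < e -> 0 <= bil (scaled_kernel f e) mu mu.
Proof.
move=> e0; rewrite (eq_bil _ _ (fun u v => scaled_kernelE u v e0)) -bil_push.
exact: posdef_bil_ge0.
Qed.

Lemma scaled_kernel_posdef e k (y : 'I_k -> 'rV[R]_d) : 0 < e -> injective y ->
  posdefmx (\matrix_(i, j) scaled_kernel f e (y i) (y j)).
Proof.
move=> e0 yinj; have yeinj : injective (fun i => e *: y i).
  by move=> i j /scalerI/yinj; apply; rewrite gt_eqF.
have := kappa_pd yeinj; congr posdefmx; apply/matrixP => i j.
by rewrite !mxE scaled_kernelE.
Qed.

Lemma sint_enum k (u : 'I_k -> R) (y : 'I_k -> 'rV[R]_d) g :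
  sint [seq (u i, y i) | i <- enum 'I_k] g = \sum_i u i * g (y i).
Proof. by rewrite /sint big_map big_enum. Qed.

(** Annihilating the columns of the Vandermonde matrix is annihilating the
    monomials of degree at most [n]; the sign is that of the first odd
    coefficient. *)
Lemma distk_quad_gt0 k (y : 'I_k -> 'rV[R]_d) (u : 'cV[R]_k) : injective y ->
  (\matrix_(i, j) mval (k := n) (y i) j)^T *m u = 0 -> u != 0 ->
  0 < (u^T *m ((-1) ^+ n.+1 *: \matrix_(i, j) distk n (y i) (y j)) *m u) 0 0.
Proof.
move=> yinj Vu u0; pose lam := [seq (u i 0, y i) | i <- enum 'I_k].
have lam0 : kills n.+1 lam.
  move=> s sn; have [j [_ jE]] := mcol_of_word R (sn : (size s <= n)%N).
  have := congr1 (fun A : 'cV_p => A j 0) Vu; rewrite !mxE => <-.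
  by rewrite sint_enum; apply: eq_bigr => i _; rewrite !mxE jE mulrC.
have quadE : (u^T *m ((-1) ^+ n.+1 *: \matrix_(i, j) distk n (y i) (y j)) *m u) 0 0
    = (-1) ^+ n.+1 * bil (distk n) lam lam.
  rewrite -scalemxAr -scalemxAl mxE; congr (_ * _).
  rewrite -mulmxA mxE [RHS]sint_enum; apply: eq_bigr => i _.
  rewrite !mxE sint_enum; congr (_ * _); apply: eq_bigr => j _.
  by rewrite !mxE mulrC.
have am_sign := odd_coef_sign odd0 fseries scaled_kernel_bil_ge0 d_gt0 am_neq0.
have form0 := distk_form_ge0 odd0 fseries scaled_kernel_bil_ge0 lam0.
rewrite quadE lt_def; apply/andP; split; last first.
  rewrite -(pmulr_rge0 _ am_sign) mulrACA -expr2 sqrr_sign mul1r.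
  exact: form0.
rewrite mulf_neq0 ?signr_eq0 //; apply: contra u0 => /eqP form_eq0.
apply/eqP/colP => i; rewrite mxE.
by apply: (distk_form_definite odd0 fseries scaled_kernel_bil_ge0 d_gt0
  am_neq0 yinj lam0 form_eq0).
Qed.

Section Points.
Variables (N : nat) (x : 'I_N -> 'rV[R]_d).
Hypothesis x_inj : injective x.
Hypothesis rankV : \rank (vandermonde n x) = p.
Variable l : nat.
Hypothesis pl : (p <= l <= N)%N.

Let pts (X : {set 'I_N}) (i : 'I_#|X|) : 'rV[R]_d := x (enum_val i).
Let L := (-1) ^+ n.+1 *: dist_mx m x.
Let wstar (X : {set 'I_N}) := (-1) ^+ p *
  \det (block_mx (principal_submx X L) (row_submx X (vandermonde n x))
                 (row_submx X (vandermonde n x))^T 0).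

Lemma pts_inj X : injective (@pts X).
Proof. by move=> i j /x_inj/enum_val_inj. Qed.

Lemma vandermondeE : vandermonde n x = \matrix_(i, j) mval (x i) j.
Proof. by apply/matrixP => i j; rewrite !mxE. Qed.

Lemma row_submxE X :
  row_submx X (vandermonde n x) = \matrix_(i, j) mval (@pts X i) j.
Proof. by rewrite vandermondeE; apply/matrixP => i j; rewrite !mxE. Qed.

Lemma dist_mxE : dist_mx m x = \matrix_(i, j) distk n (x i) (x j).
Proof. by apply/matrixP => i j; rewrite !mxE. Qed.

Lemma principal_distE X : principal_submx X L
  = (-1) ^+ n.+1 *: \matrix_(i, j) distk n (@pts X i) (@pts X j).
Proof. by apply/matrixP => i j; rewrite !mxE. Qed.

(** A subset that is not unisolvent has weight 0. *)
Lemma wstar_ge0 X : 0 <= wstar X.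
Proof.
rewrite /wstar; set V := row_submx _ _.
have [rV|rV] := eqVneq (\rank V) p; last by rewrite bordered_det_eq0 ?mulr0.
apply/ltW/bordered_det_gt0 => // u; rewrite principal_distE /V row_submxE.
by apply: distk_quad_gt0; exact: pts_inj.
Qed.

(** A maximal set of independent rows of the Vandermonde matrix, completed
    to the prescribed size. *)
Lemma wstar_gt0 : exists2 X : {set 'I_N}, #|X| = l & 0 < wstar X.
Proof.
have fV : row_full (vandermonde n x) by rewrite /row_full rankV.
pose g := fullrankfun fV; have ginj : injective g by exact: fullrankfun_inj.
have g_card : #|g @: [set: 'I_p]%SET| = p by rewrite card_imset // cardsT card_ord.
have [|X gX Xl] := @set_extension N l (g @: [set: 'I_p]%SET); first by rewrite g_card.
exists X => //; rewrite /wstar; apply: bordered_det_gt0; last first.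
  move=> u; rewrite principal_distE row_submxE.
  by apply: distk_quad_gt0; exact: pts_inj.
apply/eqP; rewrite eqn_leq rank_leq_col /=.
apply: (@leq_trans (\rank (rowsub g (vandermonde n x)))).
  by rewrite mxrank_fullrowsub.
apply: mxrankS; apply/row_subP => i.
have giX : g i \in X by apply: (fintype.subsetP gX); rewrite imset_f ?inE.
have -> : row i (rowsub g (vandermonde n x))
    = row (enum_rank_in giX (g i)) (row_submx X (vandermonde n x)).
  by apply/rowP => j; rewrite !mxE enum_rankK_in.
exact: row_sub.
Qed.

Lemma dpp_exists e : 0 < e ->
  exists P, fixed_size_dpp l (kernel_mx (scaled_kernel f e) x) P.
Proof.
move=> e0; have det_gt0 (X : {set 'I_N}) :
    0 < \det (principal_submx X (kernel_mx (scaled_kernel f e) x)).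
  have -> : principal_submx X (kernel_mx (scaled_kernel f e) x)
      = \matrix_(i, j) scaled_kernel f e (@pts X i) (@pts X j).
    by apply/matrixP => i j; rewrite !mxE.
  exact/posdefmx_det_gt0/scaled_kernel_posdef/pts_inj.
have [|X _ Xl] := @set_extension N l finset.set0.
  by rewrite cards0; case/andP: pl.
have [||P PP] := @fixed_size_law_exists R N l
  (fun X => \det (principal_submx X (kernel_mx (scaled_kernel f e) x))).
- by move=> Y _; exact: ltW.
- by exists X.
exists P; split=> //; have [sym pos] := scaled_kernel_posdef e0 x_inj.
split=> // u; have [->|u0] := eqVneq u 0; first by rewrite mulmx0 mxE.
exact/ltW/pos.
Qed.

Lemma ppdpp_exists : exists P, fixed_size_ppdpp l L (vandermonde n x) P.
Proof.
have [P PP] := @fixed_size_law_exists R N l wstar (fun X _ => wstar_ge0 X) wstar_gt0.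
exists P; split=> // [|u Vu].
  rewrite /L linearZ /=; congr (_ *: _); apply/matrixP => i j.
  by rewrite !mxE l2norm_subC.
have [->|u0] := eqVneq u 0; first by rewrite mulmx0 mxE.
apply: ltW; rewrite /L dist_mxE; apply: distk_quad_gt0 => //.
Qed.

(** A kernel vector of the Wronskian is the vector of moments of a measure on
    the given points, as these are unisolvent. *)
Lemma wronskian_unit T idx :
  (forall q, q \in T -> (size q.2.1 + size q.2.2 <= n.*2)%N) ->
  (forall e u v, evenk n a e u v = \sum_(q <- T)
     q.1 * e ^+ (size q.2.1 + size q.2.2) * (mon q.2.1 u * mon q.2.2 v)) ->
  (forall s, (size s <= n)%N -> forall u : 'rV[R]_d, mval u (idx s) = mon s u) ->
  wronskian (p := p) n T idx \in unitmx.
Proof.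
move=> T_deg T_even idxE; rewrite unitmxE unitfE; apply/negP => /det0P[v v0 vW].
have /submxP[u uV] : (v <= vandermonde n x)%MS.
  by apply: submx_full; rewrite /row_full rankV.
pose lam := [seq (u 0 i, x i) | i <- enum 'I_N].
have lamV j : sint lam (fun z => mval z j) = v 0 j.
  rewrite uV mxE sint_enum; apply: eq_bigr => i _.
  by rewrite vandermondeE mxE.
have lamM s : (size s <= n)%N -> sint lam (mon s) = v 0 (idx s).
  by move=> sn; rewrite -lamV; apply: eq_sint => z; rewrite idxE.
have low0 : low_form n T lam = 0.
  transitivity (\sum_i \sum_j v 0 i * wronskian n T idx i j * v 0 j).
    rewrite sum_wronskian; apply: eq_bigr => q /andP[q1 q2].
    by rewrite !lamM.
  rewrite exchange_big big1 // => j _; rewrite -mulr_suml.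
  have := congr1 (fun A : 'rV_p => A 0 j) vW; rewrite !mxE => ->.
  by rewrite mul0r.
have mom0 := low_form_definite odd0 fseries scaled_kernel_bil_ge0 d_gt0 am_neq0
  T_deg T_even low0.
case/negP: v0; apply/eqP/rowP => j; rewrite mxE -lamV.
have [s [sn sE]] := word_of_mcol R j.
by rewrite -(mom0 s sn); apply: eq_sint => z; rewrite sE.
Qed.

Lemma dpp_cvg (Peps : R -> {set 'I_N} -> R) (Pstar : {set 'I_N} -> R) :
  (forall e, 0 < e ->
     fixed_size_dpp l (kernel_mx (scaled_kernel f e) x) (Peps e)) ->
  fixed_size_ppdpp l L (vandermonde n x) Pstar ->
  forall X, Peps e X @[e --> (0 : R)^'+] --> Pstar X.
Proof.
move=> Pe [_ _ _ Ps].
have [T [T_deg T_even]] := even_terms d n a.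
have p_gt0 : (0 < p)%N by rewrite bin_gt0 leq_addl.
have /choice[idx idxP] (s : seq 'I_d) : exists j : 'I_p, (size s <= n)%N ->
    mdegree (mcol j) = size s /\ forall u : 'rV[R]_d, mval u j = mon s u.
  have [sn|sn] := leqP (size s) n; last by exists (Ordinal p_gt0).
  by have [j jE] := mcol_of_word R sn; exists j.
have W_unit := wronskian_unit T_deg T_even (fun s sn => (idxP s sn).2).
have lim (X : {set 'I_N}) := det_flat_limit odd0 fseries T_deg T_even
  (V := fun u j => mval u j) (dg := fun j => mdegree (mcol j)) (idx := idx)
  (@mcol_degree d n) (fun s sn => (idxP s sn).1) (fun s u sn => (idxP s sn).2 u)
  W_unit (@pts X).
have [h hP] := choice lim.
pose M e := degree_scale (fun j : 'I_p => mdegree (mcol j)) e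
  *m wronskian n T idx *m degree_scale (fun j : 'I_p => mdegree (mcol j)) e.
pose c := (-1) ^+ n.+1 * a m.
have c_gt0 : 0 < c := odd_coef_sign odd0 fseries scaled_kernel_bil_ge0 d_gt0 am_neq0.
apply: (@fixed_size_law_cvg R N l
  (fun e => (e ^+ m) ^+ l / (e ^+ m) ^+ p * \det (M e)) (fun e X => h X e)
  (fun e X => \det (principal_submx X (kernel_mx (scaled_kernel f e) x)))
  wstar (c ^+ l / c ^+ p)) => //.
- by rewrite mulf_neq0 ?invr_neq0 ?expf_neq0 ?gt_eqF.
- move=> e e0; have em0 k : (e ^+ m) ^+ k != 0 by rewrite !expf_neq0 ?gt_eqF.
  rewrite !mulf_neq0 ?invr_neq0 //.
  have D0 : \det (degree_scale (fun j : 'I_p => mdegree (mcol j)) e) != 0.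
    by rewrite det_diag; apply/prodf_neq0 => j _; rewrite mxE expf_neq0 ?gt_eqF.
  rewrite !det_mulmx !mulf_neq0 //.
  by move: W_unit; rewrite unitmxE unitfE.
- move=> e X e0 Xl; have [hE _] := hP X.
  have -> : principal_submx X (kernel_mx (scaled_kernel f e) x)
      = \matrix_(i, j) scaled_kernel f e (@pts X i) (@pts X j).
    by apply/matrixP => i j; rewrite !mxE.
  by rewrite hE // Xl.
- move=> X Xl; have [_ hlim] := hP X; apply: (cvg_eql hlim).
  have am_c : a m = c * (-1) ^+ n.+1.
    by rewrite /c mulrAC -expr2 sqrr_sign mul1r.
  rewrite am_c -scalerA -principal_distE -row_submxE /wstar mulrCA.
  congr (_ * _); have cX : c ^+ #|X| = c ^+ l by rewrite Xl.
  have c0 : c != 0 by rewrite gt_eqF.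
  rewrite mulrAC -cX -bordered_detZ // mulfK // expf_neq0 //.
- by move=> e e0; have [_] := Pe e e0.
Qed.

End Points.
End Convergence.


Theorem theorem5p3 (R : realType) (d n : nat) (x : 'I_n -> 'rV[R]_d)
    (kappa : 'rV[R]_d -> 'rV[R]_d -> R) (f : R -> R) (a : nat -> R) (r : nat) :
  (1 <= d)%N ->
  injective x ->
  posdef_kernel kappa ->
  stationary kappa f ->
  power_series_at0 f a ->
  smoothness_order a r ->
  \rank (vandermonde (r - 1) x) = 'C((r - 1) + d, d) ->
  forall m : nat, ('C((r - 1) + d, d) <= m <= n)%N ->
  [/\ (forall eps : R, 0 < eps ->
         exists P : {set 'I_n} -> R,
           fixed_size_dpp m (kernel_mx (scaled_kernel f eps) x) P),
      (exists P : {set 'I_n} -> R,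
         fixed_size_ppdpp m ((-1) ^+ r *: dist_mx (2 * r - 1) x)
           (vandermonde (r - 1) x) P) &
      (forall (Peps : R -> {set 'I_n} -> R) (Pstar : {set 'I_n} -> R),
         (forall eps : R, 0 < eps ->
            fixed_size_dpp m (kernel_mx (scaled_kernel f eps) x) (Peps eps)) ->
         fixed_size_ppdpp m ((-1) ^+ r *: dist_mx (2 * r - 1) x)
           (vandermonde (r - 1) x) Pstar ->
         forall X : {set 'I_n}, Peps eps X @[eps --> 0^'+] --> Pstar X)].
Proof.
move=> d_gt0 x_inj kappa_pd kappa_st fseries [r_gt0].
case: r r_gt0 => [//|k _].
have -> : (k.+1 - 1)%N = k by rewrite subn1.
have -> : (2 * k.+1 - 1)%N = k.*2.+1 by rewrite mul2n doubleS subn1.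
move=> am_neq0 r_min rankV m pm.
have odd0 i : odd i -> (i < k.*2.+1)%N -> a i = 0.
  move=> oi ik; apply/eqP/negPn/negP => ai.
  have iE : i = (2 * i./2.+1 - 1)%N.
    by rewrite -[LHS]odd_double_half oi mul2n doubleS subn1.
  have := r_min i./2.+1 isT; rewrite -iE => /(_ ai).
  rewrite leqNgt => /negP; apply; move: ik.
  by rewrite -[X in (X < _)%N]odd_double_half oi add1n !ltnS ltn_double.
split.
- exact: (dpp_exists kappa_pd kappa_st x_inj pm).
- exact: (ppdpp_exists d_gt0 kappa_pd kappa_st fseries odd0 am_neq0 x_inj rankV pm).
- exact: (dpp_cvg d_gt0 kappa_pd kappa_st fseries odd0 am_neq0 rankV).
Qed.
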